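(* Let $m\ge2$, $r\ge1$, let $\phi_1,\dots,\phi_r:\{0,\dots,m-1\}^2\to\mathbb{R}$, and let $\Phi:\Sigma_m^r\to\mathbb{R}$ be $\Phi(x^{(1)},\dots,x^{(r)})=\phi_1(x^{(1)}_1,x^{(1)}_2)\cdots\phi_r(x^{(r)}_1,x^{(r)}_2)$. For a Markov measure $\mu_{p,P}$ let $A(p,P)=\int_{\Sigma_m^r}\Phi\,d\mu_{p,P}^{\otimes r}$. Then $$A(p,P)=\prod_{k=1}^r\sum_{i,j=0}^{m-1}\phi_k(i,j)p_ip_{i,j},$$ and for any $\alpha$ with $E_\Phi(\alpha)\neq\emptyset$, $$h_{\rm top}(E_\Phi(\alpha))=\max_{A(p,P)=\alpha}H_2(p,P),$$ the maximum being over all couples $(p,P)$ with $A(p,P)=\alpha$.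
   Context: $\Sigma_m=\{0,\dots,m-1\}^{\mathbb{N}}$ with left shift $\sigma$; $x_1,x_2$ denote the first two coordinates of $x\in\Sigma_m$. A couple $(p,P)$ consists of a probability vector $p=(p_0,\dots,p_{m-1})$ and a stochastic matrix $P=(p_{i,j})$ with $pP=p$; $\mu_{p,P}$ is the associated shift-invariant Markov measure, $\mu_{p,P}([a_1\cdots a_n])=p_{a_1}p_{a_1,a_2}\cdots p_{a_{n-1},a_n}$, and $\mu_{p,P}^{\otimes r}$ its $r$-fold product. $H_2(p,P)=-\sum_{i=0}^{m-1}p_i\sum_{j=0}^{m-1}p_{i,j}\log p_{i,j}$ (with $0\log0=0$). $E_\Phi(\alpha)=\{x\in\Sigma_m:\lim_{n\to\infty}n^{-r}\sum_{1\le i_1,\dots,i_r\le n}\Phi(\sigma^{i_1}x,\dots,\sigma^{i_r}x)=\alpha\}$. $h_{\rm top}$ is Bowen's topological entropy of a set (defined via covers by Bowen balls $B_{n_i}(x_i,\epsilon)$ for the metrics $d_n(x,y)=\max_{0\le j<n}d(\sigma^jx,\sigma^jy)$, as the limit as $\epsilon\to0$ of the critical exponent $s$ of $\lim_n\inf\sum_ie^{-sn_i}$). *)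

(* Defs.v *)
From HB Require Import structures.
From mathcomp Require Import all_boot all_order all_algebra.
From mathcomp Require Import all_classical all_reals all_analysis.

Set Implicit Arguments.
Unset Strict Implicit.
Unset Printing Implicit Defensive.

Import Order.TTheory GRing.Theory Num.Theory.
Import numFieldNormedType.Exports.
Local Open Scope classical_set_scope.
Local Open Scope ring_scope.

(* Symbolic space Sigma_m = {0,...,m-1}^N.  We use the alphabet 'Z_m,     *)
(* which is {0,...,m-1} as soon as m >= 2 (hypothesis of the theorem).    *)
(* Coordinates are indexed from 0: the paper's x_1, x_2 are x 0, x 1.     *)


HB.instance Definition _ (m : nat) := isPointed.Build 'Z_m 0%R.

Definition Sigma (m : nat) := nat -> 'Z_m.

Definition shift (m : nat) (x : Sigma m) : Sigma m := fun k => x k.+1.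

Definition dist (R : realType) (m : nat) (x y : Sigma m) : R :=
  match pselect (exists k, (xpredC (fun k => x k == y k)) k) with
  | left h => (m%:R ^- (ex_minn h))%R
  | right _ => 0
  end.

Definition bowen_ball (R : realType) (m : nat) (n : nat) (x : Sigma m) (eps : R)
  : set (Sigma m) :=
  [set y | forall j, (j < n)%N -> dist R (iter j (@shift m) x) (iter j (@shift m) y) < eps].

Definition bowen_cover (R : realType) (m : nat) (Z : set (Sigma m)) (eps : R)
  (N : nat) (c : nat -> option (Sigma m * nat)) : Prop :=
  (forall i x n, c i = Some (x, n) -> (N <= n)%N) /\
  Z `<=` \bigcup_i (match c i with
                    | Some (x, n) => bowen_ball n x eps
                    | None => set0 end).

Definition cover_cost (R : realType) (m : nat) (s : R)
  (c : nat -> option (Sigma m * nat)) : \bar R :=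
  (\sum_(0 <= i <oo) (match c i with
                       | Some (_, n) => (expR (- (s * n%:R)))%:E
                       | None => 0%E end))%E.

Definition bowen_M (R : realType) (m : nat) (Z : set (Sigma m)) (s eps : R) (N : nat)
  : \bar R :=
  ereal_inf [set cover_cost s c | c in [set c | bowen_cover Z eps N c]].

(* m(Z, s, eps) = lim_N M(Z,s,eps,N); M is nondecreasing in N, so the
   limit is the supremum *)
Definition bowen_m (R : realType) (m : nat) (Z : set (Sigma m)) (s eps : R) : \bar R :=
  ereal_sup [set bowen_M Z s eps N | N in [set: nat]].

Definition bowen_h_eps (R : realType) (m : nat) (Z : set (Sigma m)) (eps : R) : \bar R :=
  ereal_inf [set s%:E | s in [set s : R | bowen_m Z s eps = 0%E]].

(* Bowen topological entropy: lim_{eps -> 0} h(Z, eps); h(Z,eps) is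
   nonincreasing in eps, so the limit is the supremum over eps > 0 *)
Definition htop (R : realType) (m : nat) (Z : set (Sigma m)) : \bar R :=
  ereal_sup [set bowen_h_eps Z eps | eps in [set e : R | 0 < e]].

Definition Phi (R : realType) (m r : nat) (phi : 'I_r -> 'Z_m -> 'Z_m -> R)
  (X : 'I_r -> Sigma m) : R :=
  \prod_(k < r) phi k (X k 0%N) (X k 1%N).

Definition mult_avg (R : realType) (m r : nat) (phi : 'I_r -> 'Z_m -> 'Z_m -> R)
  (n : nat) (x : Sigma m) : R :=
  (n%:R ^- r) * \sum_(I : {ffun 'I_r -> 'I_n})
                  Phi phi (fun k => iter (I k).+1 (@shift m) x).

Definition level_set (R : realType) (m r : nat) (phi : 'I_r -> 'Z_m -> 'Z_m -> R)
  (alpha : R) : set (Sigma m) :=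
  [set x | mult_avg phi n x @[n --> \oo] --> alpha].

Definition couple (R : realType) (m : nat) (p : 'Z_m -> R) (P : 'Z_m -> 'Z_m -> R)
  : Prop :=
  [/\ (forall i, 0 <= p i), \sum_i p i = 1,
      (forall i j, 0 <= P i j), (forall i, \sum_j P i j = 1)
    & (forall j, \sum_i p i * P i j = p j)].

(* H_2(p,P) = - sum_i p_i sum_j p_ij log p_ij (note ln 0 = 0, so 0 log 0 = 0) *)
Definition H2 (R : realType) (m : nat) (p : 'Z_m -> R) (P : 'Z_m -> 'Z_m -> R) : R :=
  - \sum_i p i * \sum_j P i j * ln (P i j).

Definition cylinder (m : nat) (w : seq 'Z_m) : set (Sigma m) :=
  [set x | forall k, (k < size w)%N -> x k = nth 0 w k].

(* mu_{p,P}([a_1 ... a_n]) = p_{a_1} p_{a_1 a_2} ... p_{a_{n-1} a_n};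
   for the empty word (cylinder = whole space) the value is 1 *)
Fixpoint markov_path (R : realType) (m : nat) (P : 'Z_m -> 'Z_m -> R)
  (a : 'Z_m) (w : seq 'Z_m) : R :=
  match w with
  | [::] => 1
  | b :: w' => P a b * markov_path P b w'
  end.

Definition markov_cyl (R : realType) (m : nat) (p : 'Z_m -> R)
  (P : 'Z_m -> 'Z_m -> R) (w : seq 'Z_m) : R :=
  match w with
  | [::] => 1
  | a :: w' => p a * markov_path P a w'
  end.

(* The product space Sigma_m^r, with the product sigma-algebra, generated by
   products of cylinders *)
Definition rect (m r : nat) (c : 'I_r -> seq 'Z_m) : set ('I_r -> Sigma m) :=
  [set X | forall k, cylinder (c k) (X k)].

Definition rects (m r : nat) : set (set ('I_r -> Sigma m)) :=
  [set rect c | c in [set: 'I_r -> seq 'Z_m]].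

Definition SigmaR (m r : nat) := g_sigma_algebraType (@rects m r).

(* nu is the r-fold product mu_{p,P}^{(x) r} of the Markov measure mu_{p,P}:
   it is characterised (uniquely, by the pi-lambda theorem) by its values on
   products of cylinders *)
Definition is_markov_prod (R : realType) (m r : nat) (p : 'Z_m -> R)
  (P : 'Z_m -> 'Z_m -> R) (nu : {measure set (SigmaR m r) -> \bar R}) : Prop :=
  forall c : 'I_r -> seq 'Z_m,
    nu (rect c : set (SigmaR m r)) = (\prod_(k < r) markov_cyl p P (c k))%:E.

Definition Aint (R : realType) (m r : nat) (phi : 'I_r -> 'Z_m -> 'Z_m -> R)
  (nu : {measure set (SigmaR m r) -> \bar R}) : \bar R :=
  (\int[nu]_(X in [set: SigmaR m r]) (Phi phi X)%:E)%E.

(* Main.v *)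
Require Import Defs.
From HB Require Import structures.
From mathcomp Require Import all_boot all_order all_algebra.
From mathcomp Require Import all_classical all_reals all_analysis.
From mathcomp Require Import measurable_realfun ring lra zify.

(** Since [Phi] is a product, the multiple average at [x] is a product of Birkhoff
    averages, that is, a polynomial [Fmean] of the empirical distribution of the
    pairs of consecutive letters of [x].  A shift-invariant pair distribution [q]
    is the same thing as a couple [(p, P)], and [H_2(p, P)] is the conditional
    entropy of [q].

    Upper bound.  Every limit of empirical pair distributions along a point of the
    level set is shift-invariant and satisfies [Fmean q = alpha].  By compactness
    and continuity of the entropy, the long prefixes of such points have empirical
    entropy at most the maximum plus [delta].  The words of a given type are
    counted with the Markov chain defined by the type: each of them has probability
    [exp(- n H(type))], and there are polynomially many types.

    Lower bound.  The couple may be reducible, so its Markov measure need not be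
    carried by the level set.  The chain is made mixing by restarting it from [p]
    with small probability, which does not change [p]; a martingale argument then
    provides at least [exp(l (H - delta))] words of length [l] whose pair counts
    are [delta]-close to [q].  Concatenating such blocks with [delta -> 0] slowly
    gives a subset of the level set on which the cylinders of a countable cover
    can be counted after a compactness reduction. *)

Import Order.TTheory GRing.Theory Num.Theory.
Import numFieldNormedType.Exports.
Local Open Scope classical_set_scope.
Local Open Scope ring_scope.

Set Implicit Arguments.
Unset Strict Implicit.

(** * Words and pair counts *)

Section Words.
Variables (R : realType) (A : finType).
Implicit Types (f g : A -> A -> R) (a b : A) (w v : seq A).

Fixpoint words (n : nat) : seq (seq A) :=
  if n is k.+1 then [seq a :: w | a <- enum A, w <- words k] else [:: [::]].

Lemma mem_words n w : (w \in words n) = (size w == n).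
Proof.
elim: n w => [|n IH] w /=; first by rewrite inE size_eq0.
apply/allpairsP/idP => [[[a v] /= [_ hv ->]]|]; first by rewrite /= eqSS -IH.
by case: w => // a w; rewrite /= eqSS -IH => hw; exists (a, w); rewrite mem_enum.
Qed.

Lemma uniq_words n : uniq (words n).
Proof.
elim: n => //= n IH; apply: allpairs_uniq => //; first exact: enum_uniq.
by move=> [a w] [b v] _ _ /= [-> ->].
Qed.

Lemma big_words (G : seq A -> R) n :
  \sum_(w <- words n.+1) G w = \sum_a \sum_(w <- words n) G (a :: w).
Proof. by rewrite /= big_allpairs_dep big_enum. Qed.

(** The first letter [a] is kept apart from the rest [w], so that [size w] is exactly the number of
    consecutive pairs. *)
Fixpoint psum f a w : R :=
  if w is b :: w' then f a b + psum f b w' else 0.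

Fixpoint pcount (ij : A * A) a w : nat :=
  if w is b :: w' then (((a, b) == ij) + pcount ij b w')%N else 0%N.

Fixpoint pprod f a w : R :=
  if w is b :: w' then f a b * pprod f b w' else 1.

Lemma psumE f a w : psum f a w = \sum_ij f ij.1 ij.2 * (pcount ij a w)%:R.
Proof.
elim: w a => [|b w IH] a /=; first by rewrite big1// => i _; rewrite mulr0.
rewrite IH [RHS](eq_bigr (fun ij => f ij.1 ij.2 * ((a, b) == ij)%:R +
   f ij.1 ij.2 * (pcount ij b w)%:R)); last by move=> i _; rewrite natrD mulrDr.
rewrite big_split /=; congr (_ + _).
rewrite (bigD1 (a, b))//= eqxx mulr1 big1 ?addr0// => i.
by rewrite eq_sym => /negbTE ->; rewrite mulr0.
Qed.

Lemma pprodE f a w : pprod f a w = \prod_ij f ij.1 ij.2 ^+ pcount ij a w.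
Proof.
elim: w a => [|b w IH] a /=; first by rewrite big1// => i _; rewrite expr0.
rewrite IH [RHS](eq_bigr (fun ij => f ij.1 ij.2 ^+ ((a, b) == ij) *
   f ij.1 ij.2 ^+ (pcount ij b w))); last by move=> i _; rewrite exprD.
rewrite big_split /=; congr (_ * _).
rewrite (bigD1 (a, b))//= eqxx expr1 big1 ?mulr1// => i.
by rewrite eq_sym => /negbTE ->; rewrite expr0.
Qed.

Lemma pprod_ge0 f a w : (forall i j, 0 <= f i j) -> 0 <= pprod f a w.
Proof. by move=> f0; elim: w a => //= b w IH a; rewrite mulr_ge0. Qed.

(** Rows of sum below 1 are allowed: the empirical transition matrix of a word has zero rows at the
    letters that the word never leaves. *)
Lemma sum_pprod_le1 f a n : (forall i j, 0 <= f i j) ->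
  (forall i, \sum_j f i j <= 1) -> \sum_(w <- words n) pprod f a w <= 1.
Proof.
move=> f0 f1; elim: n a => [|n IH] a; first by rewrite big_seq1.
rewrite big_words; apply: (le_trans _ (f1 a)); apply: ler_sum => b _ /=.
by rewrite -mulr_sumr ler_piMr.
Qed.

Lemma sum_pprod f a n : 
  (forall i, \sum_j f i j = 1) -> \sum_(w <- words n) pprod f a w = 1.
Proof.
move=> f1; elim: n a => [|n IH] a; first by rewrite big_seq1.
rewrite big_words -(f1 a); apply: eq_bigr => b _ /=.
by rewrite -mulr_sumr IH mulr1.
Qed.

Lemma sum_pcount a w : (\sum_ij pcount ij a w)%N = size w.
Proof.
elim: w a => [|b w IH] a /=; first by rewrite big1.
rewrite big_split /= IH (bigD1 (a, b))//= eqxx big1 ?addn0 ?add1n// => i.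
by rewrite eq_sym => /negbTE ->.
Qed.

Lemma pcount_le ij a w : (pcount ij a w <= size w)%N.
Proof. by rewrite -(sum_pcount a w) (bigD1 ij) //= leq_addr. Qed.

(* Departures from [i] minus arrivals at [i] telescope along the word. *)
Lemma pcount_balance i a w :
  \sum_j (pcount (i, j) a w)%:R - \sum_j (pcount (j, i) a w)%:R
  = (a == i)%:R - (last a w == i)%:R :> R.
Proof.
elim: w a => [|b w IH] a /=; first by rewrite !big1 ?subrr.
under eq_bigr do rewrite natrD; rewrite big_split /=.
under [X in _ - X]eq_bigr do rewrite natrD; rewrite [X in _ - X]big_split /=.
have -> : \sum_j ((a, b) == (i, j))%:R = (a == i)%:R :> R.
  rewrite (bigD1 b)//= xpair_eqE eqxx andbT big1 ?addr0// => j.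
  by rewrite xpair_eqE eq_sym => /negbTE ->; rewrite andbF.
have -> : \sum_j ((a, b) == (j, i))%:R = (b == i)%:R :> R.
  rewrite (bigD1 a)//= xpair_eqE eqxx big1 ?addr0// => j.
  by rewrite xpair_eqE eq_sym => /negbTE ->.
by move: (IH b); lra.
Qed.

End Words.

(** * Moments of martingale sums along a Markov chain *)

Section Moment.
Variables (R : realType) (A : finType).
Implicit Types (f g : A -> A -> R).

Lemma sum_pprod_psum f g a n : (forall i, \sum_j f i j = 1) ->
  (forall i, \sum_j f i j * g i j = 0) ->
  \sum_(w <- words A n) pprod f a w * psum g a w = 0.
Proof.
move=> f1 fg; elim: n a => [|n IH] a; first by rewrite big_seq1 mulr0.
rewrite big_words; transitivity (\sum_j f a j * g a j); last exact: fg.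
apply: eq_bigr => b _ /=.
transitivity (f a b * g a b * (\sum_(w <- words A n) pprod f b w)
   + f a b * \sum_(w <- words A n) pprod f b w * psum g b w).
  rewrite !mulr_sumr -big_split /=.
  by apply: eq_bigr => w _; ring.
by rewrite IH sum_pprod// mulr0 addr0 mulr1.
Qed.

(* The increments of [psum g] are martingale differences: the cross terms of
   the square vanish. *)
Lemma sum_pprod_psum_sqr f g C a n : (forall i j, 0 <= f i j) ->
  (forall i, \sum_j f i j = 1) -> (forall i, \sum_j f i j * g i j = 0) ->
  (forall i j, g i j ^+ 2 <= C) ->
  \sum_(w <- words A n) pprod f a w * psum g a w ^+ 2 <= C * n%:R.
Proof.
move=> f0 f1 fg gC; elim: n a => [|n IH] a.
  by rewrite big_seq1 mulr0 expr0n mulr0.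
have -> : C * n.+1%:R = \sum_j f a j * (C * n.+1%:R) by rewrite -mulr_suml f1 mul1r.
rewrite big_words.
apply: ler_sum => b _ /=.
rewrite (eq_bigr (fun w => f a b * (pprod f b w * psum g b w ^+ 2) +
   (f a b * (2 * g a b)) * (pprod f b w * psum g b w) +
   (f a b * g a b ^+ 2) * pprod f b w)); last by move=> w _; ring.
rewrite !big_split /= -!mulr_sumr sum_pprod_psum// sum_pprod// mulr0 addr0 mulr1.
rewrite -mulrDr ler_wpM2l//. by rewrite -[n.+1]addn1 natrD mulrDr mulr1 lerD.
Qed.

End Moment.

(** * Entropy of pair distributions *)

Section Entropy.
Variable R : realType.

(** As [ln] vanishes on nonpositive reals, [eta] extends $-x\log x$ by 0 to the left of 0, which
    makes it continuous on the whole line. *)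
Definition eta (x : R) : R := - (x * ln x).

Lemma eta_le0 x : x <= 0 -> eta x = 0.
Proof. by move=> x0; rewrite /eta ln0// mulr0 oppr0. Qed.

(** With $s=\sqrt x$, $-\ln x=2\ln(1/s)\le 2/s$, hence $-x\ln x\le 2s$. This gives the continuity of
    [eta] at 0. *)
Lemma eta_bound (x : R) : 0 < x < 1 -> `|eta x| <= 2 * Num.sqrt x.
Proof.
move=> /andP[x0 x1]; rewrite /eta normrN normrM gtr0_norm// ler0_norm; last by rewrite ln_le0// ltW.
have s0 : 0 < Num.sqrt x by rewrite sqrtr_gt0.
have xE : x = Num.sqrt x ^+ 2 by rewrite sqr_sqrtr// ltW.
have lnE : - ln x = 2 * ln (Num.sqrt x)^-1.
  by rewrite {1}xE lnXn// lnV// mulrN mulr_natl.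
have : ln (Num.sqrt x)^-1 < (Num.sqrt x)^-1 by rewrite ln_sublinear// invr_gt0.
rewrite lnE; set v := ln _ => h.
have : Num.sqrt x * v <= 1.
  rewrite (le_trans (ler_wpM2l (ltW s0) (ltW h)))// mulfV ?gt_eqF//.
move/(ler_wpM2l (ltW s0)) => hs.
rewrite {1}xE; move: hs; set s := Num.sqrt x => hs.
rewrite (_ : s ^+ 2 * (2 * v) = 2 * (s * (s * v))); last by ring.
by rewrite ler_pM2l// -[leRHS]mulr1.
Qed.

Lemma eta_continuous : continuous eta.
Proof.
move=> x; have [x0|x0|->] := ltgtP x 0.
- rewrite /continuous_at (eta_le0 (ltW x0)).
  apply: cvg_near_cst; near=> y; rewrite eta_le0//; apply: ltW.
  by near: y; exact: lt_nbhsl.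
- by apply: cvgN; apply: cvgM; [exact: cvg_id|exact: continuous_ln].
- rewrite /continuous_at (eta_le0 (lexx _)); apply/cvgrPdist_lt => e e0.
  near=> y; rewrite sub0r normrN.
  have [y0|y0] := leP y 0; first by rewrite eta_le0// normr0.
  have yd : y < Num.min 1 ((e / 2) ^+ 2).
    near: y; apply: num_topology.nbhs0_lt; rewrite lt_min ltr01/=; rewrite exprn_gt0//; lra.
  move: yd; rewrite lt_min => /andP[y1 ye].
  apply: (le_lt_trans (eta_bound _)); first by rewrite y0.
  suff : Num.sqrt y < e / 2 by lra.
  have he : 0 < e / 2 by lra.
  by rewrite -(ger0_norm (ltW he)) -sqrtr_sqr ltr_sqrt// exprn_gt0.
Unshelve. all: by end_near. Qed.

(** For [a] positive this is $\ln t\le t-1$ at $t=z/a$, multiplied by [a]. *)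
Lemma gibbs (a z : R) : 0 <= a -> 0 < z -> a * ln z <= a * ln a + z - a.
Proof.
rewrite le_eqVlt => /orP[/eqP <-|a0] z0; first by rewrite !mul0r; lra.
have h : ln (z / a) <= z / a - 1.
  have := divr_gt0 z0 a0; set t := z / a => t0.
  rewrite (_ : ln t = ln (1 + (t - 1))); last by congr ln; lra.
  by apply: le_ln1Dx; lra.
move: h; rewrite lnM ?posrE ?invr_gt0// lnV ?posrE// => h.
have az : a * (z / a) = z by rewrite mulrC divfK// gt_eqF.
have := ler_wpM2l (ltW a0) h; rewrite !mulrDr mulrN az; lra.
Qed.

(** Apply [gibbs] to [a] and to [b] with [z] their convex combination: the linear terms cancel on
    averaging. If [z] is 0, both weighted terms vanish. *)
Lemma eta_concave (t a b : R) : 0 <= t <= 1 -> 0 <= a -> 0 <= b ->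
  (1 - t) * eta a + t * eta b <= eta ((1 - t) * a + t * b).
Proof.
move=> /andP[t0 t1] a0 b0; set z := _ + t * b.
have t1' : 0 <= 1 - t by lra.
have za : 0 <= (1 - t) * a by exact: mulr_ge0.
have zb : 0 <= t * b by exact: mulr_ge0.
have : 0 <= z by exact: addr_ge0.
rewrite le_eqVlt => /orP[/eqP z0|z0].
  have ha : (1 - t) * a = 0 by apply/eqP; rewrite eq_le za andbT; rewrite z0 /z; lra.
  have hb : t * b = 0 by apply/eqP; rewrite eq_le zb andbT; rewrite z0 /z; lra.
  rewrite -z0 (eta_le0 (lexx 0)) /eta !mulrN.
  have : (1 - t) * a * ln a = 0 by rewrite ha mul0r.
  have : t * b * ln b = 0 by rewrite hb mul0r.
  by lra.
have ha := ler_wpM2l t1' (gibbs a0 z0).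
have hb := ler_wpM2l t0 (gibbs b0 z0).
have hz : z = (1 - t) * a + t * b by [].
rewrite /eta {2}hz; nra.
Qed.

Variable A : finType.
Implicit Types q : A * A -> R.

(** The conditional entropy of the second letter given the first, written as a difference of two
    entropies. No quotient occurs, so continuity in [q] is immediate. *)
Definition pair_entropy q : R := \sum_ij eta (q ij) - \sum_i eta (\sum_j q (i, j)).

Lemma pair_entropyE q : (forall ij, 0 <= q ij) ->
  pair_entropy q = - \sum_ij q ij * ln (q ij / \sum_j q (ij.1, j)).
Proof.
move=> q0; rewrite /pair_entropy.
have -> : \sum_i eta (\sum_j q (i, j)) =
    \sum_ij (- (q ij * ln (\sum_j q (ij.1, j)))).
  transitivity (\sum_i \sum_j - (q (i, j) * ln (\sum_k q (i, k)))); last first.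
    by rewrite pair_bigA; apply: eq_bigr => -[].
  by apply: eq_bigr => i _; rewrite sumrN -mulr_suml.
rewrite -sumrB -sumrN; apply: eq_bigr => -[i j] _ /=.
have := q0 (i, j); rewrite le_eqVlt => /orP[/eqP <-|qp].
  by rewrite /eta !mul0r; lra.
have sp : 0 < \sum_j q (i, j).
  by rewrite (bigD1 j)//= ltr_wpDr// sumr_ge0.
by rewrite lnM ?posrE ?invr_gt0// lnV ?posrE// /eta; lra.
Qed.
End Entropy.

(** * Maximization under an approximate constraint *)

Section LevelMax.
Variable R : realType.

(** By compactness [d] attains the value 0 on [C], and [H] has a maximum on the zero set. On the
    compact set where [H] exceeds this maximum by [delta], [d] has a positive minimum; half of it is
    the required [e]. *)
Lemma approx_level_max (T : topologicalType) (C : set T) (d H : T -> R) :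
  compact C -> continuous d -> continuous H -> (forall q, C q -> 0 <= d q) ->
  (forall e : R, 0 < e -> exists2 q, C q & d q <= e) ->
  exists q, [/\ C q, d q = 0 & forall delta : R, 0 < delta -> exists2 e : R, 0 < e &
    forall q', C q' -> d q' <= e -> H q' <= H q + delta].
Proof.
move=> Cco dc Hc d0 dex.
have C0 : C !=set0 by have [q Cq _] := dex 1 ltr01; exists q.
have [q0 /set_mem Cq0 q0min] := compact_EVT_min C0 Cco (continuous_subspaceT dc).
have dq0 : d q0 = 0.
  apply/eqP; rewrite eq_le d0// andbT leNgt; apply/negP => dq0.
  have h : 0 < d q0 / 2 by lra.
  have [q Cq dq] := dex (d q0 / 2) h.
  by have := q0min q (mem_set Cq); lra.
pose K := C `&` d @^-1` [set x | x = 0].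
have Kco : compact K.
  apply: compact_closedI => //; apply: preimage_closed (@closed_eq R 0).
  by move=> x _; exact: dc.
have K0 : K !=set0 by exists q0.
have [q /set_mem[Cq dq] qmax] := compact_EVT_max K0 Kco (continuous_subspaceT Hc).
exists q; split=> // delta delta0.
pose L := C `&` H @^-1` [set x | H q + delta <= x].
have Lco : compact L.
  apply: compact_closedI => //; apply: preimage_closed (@closed_ge R _).
  by move=> x _; exact: Hc.
have [L0|L0] := pselect (L !=set0); last first.
  exists 1 => // q' Cq' _; rewrite leNgt; apply/negP => h.
  by apply: L0; exists q'; split => //=; exact: ltW.
have [q1 /set_mem[Cq1 Hq1] q1min] := compact_EVT_min L0 Lco (continuous_subspaceT dc).
have dq1 : 0 < d q1.
  rewrite lt_neqAle d0// andbT eq_sym; apply/eqP => dq1.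
  have : H q1 <= H q by apply: qmax; apply: mem_set.
  by move: Hq1 => /=; lra.
exists (d q1 / 2); first by lra.
move=> q' Cq' dq'; rewrite leNgt; apply/negP => h.
have : d q1 <= d q' by apply: q1min; apply: mem_set; split => //=; exact: ltW.
lra.
Qed.
End LevelMax.

(** * Counting words by type *)

Section TypeCounting.
Variables (R : realType) (A : finType).

Definition pair_freq (a : A) (w : seq A) : A * A -> R :=
  fun ij => (pcount ij a w)%:R / (size w)%:R.

Lemma pair_freq_ge0 a w ij : 0 <= pair_freq a w ij.
Proof. by rewrite divr_ge0. Qed.

Lemma pprod_pair_freq a w : (0 < size w)%N ->
  pprod (fun i j => pair_freq a w (i, j) / \sum_k pair_freq a w (i, k)) a w =
  expR (- ((size w)%:R * pair_entropy (pair_freq a w))).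
Proof.
move=> w0; have wR : (size w)%:R != 0 :> R by rewrite pnatr_eq0 -lt0n.
rewrite pair_entropyE; last exact: pair_freq_ge0.
rewrite mulrN opprK mulr_sumr expR_sum pprodE; apply: eq_bigr => -[i j] _ /=.
set f := _ / \sum_k _; rewrite /pair_freq mulrA [_%:R * (_ / _)]mulrC divfK//.
case: (posnP (pcount (i, j) a w)) => [->|c0]; first by rewrite mul0r expR0.
rewrite expRM_natl lnK// posrE /f.
have e0 : 0 < pair_freq a w (i, j) by rewrite divr_gt0 ?ltr0n.
rewrite divr_gt0// (bigD1 j)//= ltr_wpDr// sumr_ge0// => k _; exact: pair_freq_ge0.
Qed.

Lemma count_words_le (n : nat) (a : A) (G : pred (seq A)) (h : R) : (0 < n)%N ->
  (forall w, size w = n -> G w -> pair_entropy (pair_freq a w) <= h) ->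
  \sum_(w <- words A n | G w) 1 <=
    n.+1%:R ^+ #|{: A * A}| * expR (n%:R * h) :> R.
Proof.
move=> n0 Gh.
(* [inord] loses nothing on words of length [n], whose counts are all at most [n]. *)
pose ty w : {ffun A * A -> 'I_n.+1} := [ffun ij => inord (pcount ij a w)].
have tyE w1 w2 : size w1 = n -> size w2 = n -> ty w1 = ty w2 ->
    pair_freq a w1 = pair_freq a w2.
  move=> s1 s2 /ffunP t12; apply/funext => ij; rewrite /pair_freq s1 s2.
  move/(_ ij): t12; rewrite !ffunE => /(congr1 val) /=.
  by rewrite !inordK ?ltnS ?(leq_trans (pcount_le _ _ _)) ?s1 ?s2// => ->.
rewrite (partition_big ty xpredT)//=.
have -> : n.+1%:R ^+ #|{: A * A}| * expR (n%:R * h) =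
    \sum_(N : {ffun A * A -> 'I_n.+1}) expR (n%:R * h).
  by rewrite sumr_const card_ffun card_ord -[RHS]mulr_natl natrX.
apply: ler_sum => N _.
have [/hasP[w0 w0n /andP[Gw0 /eqP tw0]]|/hasPn nex] :=
  boolP (has (fun w => G w && (ty w == N)) (words A n)); last first.
  by rewrite big_seq_cond big1 ?expR_ge0// => w /andP[/nex/negbTE ->].
move: w0n; rewrite mem_words => /eqP w0n.
(* The empirical transition matrix of [w0]. Under it each word of the same type has probability at
   least $e^{-nh}$, and the total mass is at most 1. *)
pose f i j := pair_freq a w0 (i, j) / \sum_k pair_freq a w0 (i, k).
have f0 i j : 0 <= f i j.
  by rewrite divr_ge0 ?pair_freq_ge0// sumr_ge0// => k _; exact: pair_freq_ge0.
have f1 i : \sum_j f i j <= 1.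
  rewrite /f -mulr_suml; set S := \sum_j _.
  by have [->|S0] := eqVneq S 0; [rewrite mul0r|rewrite divff].
rewrite -[leRHS]mulr1 -ler_pdivrMl ?expR_gt0// -expRN.
apply: le_trans (sum_pprod_le1 a n f0 f1).
rewrite mulr_sumr [leRHS](bigID (fun w => G w && (ty w == N))) /=.
rewrite ler_wpDr//; first by apply: sumr_ge0 => w _; apply: pprod_ge0.
rewrite big_seq_cond [leRHS]big_seq_cond; apply: ler_sum => w.
rewrite mem_words mulr1 => /andP[/eqP wn /andP[Gw /eqP tw]].
have e : pair_freq a w0 = pair_freq a w by apply: tyE => //; rewrite tw0 tw.
have -> : f = fun i j => pair_freq a w (i, j) / \sum_k pair_freq a w (i, k).
  by rewrite /f e.
rewrite pprod_pair_freq ?wn// ler_expR lerN2 ler_wpM2l//; exact: Gh.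
Qed.

(** Sorting the list by length. It bounds a partial sum of a cover cost, whose terms come from
    distinct words. *)
Lemma sum_uniq_words_le (s : seq (seq A)) (B : nat) (T : seq A -> R) :
  uniq s -> (forall w, w \in s -> (size w < B)%N) -> (forall w, 0 <= T w) ->
  \sum_(w <- s) T w <= \sum_(n < B) \sum_(w <- words A n) T w.
Proof.
move=> us sB T0.
have -> : \sum_(w <- s) T w = \sum_(n < B) \sum_(w <- s | size w == n) T w.
  rewrite (exchange_big_dep xpredT)//= big_seq_cond [RHS]big_seq_cond.
  apply: eq_bigr => w /andP[ws _].
  by rewrite (big_pred1 (Ordinal (sB w ws))).
apply: ler_sum => n _; rewrite -big_filter.
have fs w : (w \in [seq w <- s | size w == n]) = (w \in words A n) && (w \in s).
  by rewrite mem_filter mem_words.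
rewrite [leRHS](bigID (mem s)) /= ler_wpDr ?sumr_ge0//.
rewrite -[leRHS]big_filter (perm_big [seq w <- words A n | w \in s])//.
apply: uniq_perm; rewrite ?filter_uniq ?uniq_words// => w.
by rewrite fs mem_filter andbC.
Qed.

End TypeCounting.

(** * Upper bound by word covers *)

Section BowenBalls.
Variables (R : realType) (m : nat).
Implicit Types x y : Sigma m.

Lemma iter_shiftE x j k : iter j (@Defs.shift m) x k = x (k + j)%N.
Proof. by elim: j k => [|j IH] k /=; rewrite ?addn0// /Defs.shift IH addnS. Qed.

Lemma dist_le x y L : (1 < m)%N -> (forall k, (k < L)%N -> x k = y k) ->
  dist R x y <= m%:R ^- L.
Proof.
move=> hm xy; rewrite /dist; case: pselect => [h|_]; last by rewrite invr_ge0 exprn_ge0.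
case: ex_minnP => k /eqP xyk _.
have Lk : (L <= k)%N by rewrite leqNgt; apply/negP => /xy.
rewrite lef_pV2 ?posrE ?exprn_gt0 ?ltr0n ?(ltn_trans _ hm)//.
by rewrite ler_weXn2l// ler1n ltnW.
Qed.

(** Take [l] with $m^{-l}<\epsilon$: agreement on [n + l] letters leaves at least [l] common letters
    after each shift by [j < n]. *)
Lemma cylinder_sub_bowen_ball (eps : R) : (1 < m)%N -> 0 < eps ->
  exists l, forall n x y, (forall k, (k < n + l)%N -> x k = y k) ->
    bowen_ball n x eps y.
Proof.
move=> hm e0.
have [l hl] : exists l : nat, m%:R ^- l < eps :> R.
  have : (m%:R^-1 : R) ^+ n @[n --> \oo] --> 0.
    by apply: cvg_expr; rewrite normfV ger0_norm ?ler0n// invf_lt1 ?ltr1n// ltr0n ltnW.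
  move/cvgrPdist_lt => /(_ _ e0) [l _ /(_ l (leqnn l))].
  rewrite sub0r normrN ger0_norm ?exprn_ge0 ?invr_ge0// exprVn => ?.
  by exists l.
exists l => n x y xy j jn; apply: le_lt_trans hl; apply: dist_le => // k kl.
by rewrite !iter_shiftE xy//; lia.
Qed.

(** A disagreement at the first letter gives distance $m^0=1$, so at scale 1 each shift tests one
    letter. *)
Lemma bowen_ball1 n x y : bowen_ball n x (1 : R) y -> forall k, (k < n)%N -> x k = y k.
Proof.
move=> h k /h; rewrite /dist; case: pselect => [e|ne _].
  case: ex_minnP => -[|j] /= jxy jmin; first by rewrite expr0 invr1 ltxx.
  move=> _; have [//|xy] := eqVneq (x k) (y k).
  by have := jmin 0%N; rewrite !iter_shiftE add0n => /(_ xy).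
have [//|xy] := eqVneq (x k) (y k).
by exfalso; apply: ne; exists 0%N; rewrite /= !iter_shiftE add0n.
Qed.

End BowenBalls.

Section UpperBound.
Variables (R : realType) (m : nat).

(** At the exponent [h + 2 delta] the good words of length [k] cost at most $c\,e^{sl}\rho^k$ with
    $\rho=e^{-\delta}$, and the tail of this geometric series tends to 0. *)
Lemma htop_le_words (Z : set (Sigma m)) (h : R) : (1 < m)%N ->
  (forall delta : R, 0 < delta -> exists (G : pred (seq 'Z_m)) (c : R),
     (forall n, \sum_(w <- words 'Z_m n | G w) 1 <= c * expR (n%:R * (h + delta))) /\
     (forall x, Z x -> \forall n \near \oo, G (mkseq x n))) ->
  (htop R Z <= h%:E)%E.
Proof.
move=> hm hZ; apply: ge_ereal_sup => _ [eps /= e0 <-].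
apply/lee_addgt0Pr => delta' delta'0; rewrite -EFinD.
pose delta := delta' / 2; have d0 : 0 < delta by rewrite /delta; lra.
have [G [c [Gc ZG]]] := hZ delta d0.
have c0 : 0 <= c.
  have := le_trans (sumr_ge0 _ _) (Gc 0%N); rewrite mul0r expR0 mulr1; exact.
apply: ereal_inf_lbound; exists (h + delta') => //=; set s := h + delta'.
have [l hl] := @cylinder_sub_bowen_ball R m eps hm e0.
pose rho : R := expR (- delta).
have rho0 : 0 < rho by exact: expR_gt0.
have rho1 : rho < 1 by rewrite /rho -expR0 ltr_expR; lra.
pose K := c * expR (s * l%:R) / (1 - rho).
have K0 : 0 <= K by rewrite /K divr_ge0 ?mulr_ge0 ?expR_ge0//; lra.
(* A single cover, by the good words of all lengths at least [M], serves the
   whole of [Z], so that countable stability of the entropy is not needed. *)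
have cost M : (l <= M)%N -> (bowen_M Z s eps (M - l) <= (K * rho ^+ M)%:E)%E.
  move=> lM.
  pose ok w := G w && (M <= size w)%N.
  (* The words are enumerated by [pickle] and extended by zeros to give centres. The order is
     [size w - l] because a cylinder of length [n + l] lies in a Bowen ball of order [n]. *)
  pose cov i : option (Sigma m * nat) :=
    if (pickle_inv i : option (seq 'Z_m)) is Some w then
      if ok w then Some ((fun k => nth 0 w k) : Sigma m, (size w - l)%N) else None
    else None.
  apply: (@le_trans _ _ (cover_cost s cov)).
    apply: ereal_inf_lbound; exists cov => //=; split.
      move=> i x n; rewrite /cov; case: pickle_inv => // w.
      by case: ifP => // /andP[_ Mw] [_ <-]; rewrite leq_sub2r.
    move=> x /ZG [N _ hN]; pose n := maxn N M.
    exists (pickle (mkseq x n)) => //; rewrite /cov pickleK_inv.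
    have -> : ok (mkseq x n).
      by rewrite /ok size_mkseq leq_maxr andbT; apply: hN; rewrite /= leq_maxl.
    rewrite size_mkseq; apply: hl => k; rewrite subnK; last first.
      by rewrite (leq_trans lM)// leq_maxr.
    by move=> kn; rewrite nth_mkseq.
  pose T w : R := if ok w then expR (- (s * (size w - l)%:R)) else 0.
  have T0 w : 0 <= T w by rewrite /T; case: ifP => // _; exact: expR_ge0.
  have -> : cover_cost s cov =
      (\sum_(0 <= i <oo) (oapp T 0 (pickle_inv i : option (seq 'Z_m)))%:E)%E.
    apply: eq_eseriesr => i _; rewrite /cov; case: pickle_inv => //= w.
    by rewrite /T; case: ifP.
  apply: lime_le.
    apply: is_cvg_nneseries => i _ _; by case: pickle_inv => //= w.
  apply: nearW => n; rewrite sumEFin lee_fin big_mkord.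
  (* The words met among the first [n] indices; they are distinct since [pickle_inv] is a partial
     inverse of [pickle]. *)
  pose ws : seq (seq 'Z_m) := pmap (@pickle_inv _) (iota 0 n).
  have -> : \sum_(i < n) oapp T 0 (pickle_inv i) = \sum_(w <- ws) T w.
    rewrite big_pmap -(big_mkord xpredT (fun i => oapp T 0 (pickle_inv i))) /index_iota subn0.
    by [].
  have uws : uniq ws.
    apply: (@pmap_uniq _ _ _ pickle); last exact: iota_uniq.
    exact: pickle_invK.
  pose B := (\max_(w <- ws) size w).+1.
  have wsB w : w \in ws -> (size w < B)%N.
    by move=> wws; rewrite ltnS (big_rem w)//= leq_maxl.
  apply: (le_trans (sum_uniq_words_le uws wsB T0)).
  have bd (k : nat) : \sum_(w <- words 'Z_m k) T w <=
      if (M <= k)%N then c * expR (s * l%:R) * rho ^+ k else 0.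
    case: ifPn => Mk; last first.
      rewrite big_seq big1// => w; rewrite mem_words => /eqP wk.
      by rewrite /T /ok wk (negbTE Mk) andbF.
    have -> : \sum_(w <- words 'Z_m k) T w =
        expR (- (s * (k - l)%:R)) * \sum_(w <- words 'Z_m k | G w) 1.
      rewrite mulr_sumr [RHS]big_mkcond big_seq [RHS]big_seq.
      apply: eq_bigr => w; rewrite mem_words => /eqP wk.
      by rewrite /T /ok wk Mk andbT mulr1.
    rewrite (le_trans (ler_wpM2l (expR_ge0 _) (Gc k)))//.
    rewrite mulrCA -mulrA ler_wpM2l// -expRD /rho -expRM_natl -expRD ler_expR.
    rewrite natrB ?(leq_trans lM)// /s /delta; lra.
  apply: (@le_trans _ _ (\sum_(M <= k < M + B) c * expR (s * l%:R) * rho ^+ k)).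
    have nn k : 0 <= c * expR (s * l%:R) * rho ^+ k.
      by rewrite !mulr_ge0 ?expR_ge0 ?exprn_ge0// ltW.
    apply: (@le_trans _ _ (\sum_(k < B) if (M <= k)%N then
        c * expR (s * l%:R) * rho ^+ k else 0)); first by apply: ler_sum.
    rewrite -(big_mkord xpredT (fun k => if (M <= k)%N then _ * rho ^+ k else 0)).
    apply: (@le_trans _ _ (\sum_(0 <= k < M + B) if (M <= k)%N then
        c * expR (s * l%:R) * rho ^+ k else 0)).
      rewrite [leRHS](big_cat_nat (n := B)) ?leq_addl//= ler_wpDr//.
      by apply: sumr_ge0 => k _; case: ifP.
    rewrite (big_cat_nat (n := M)) ?leq_addr//= big_nat big1 ?add0r; last first.
      by move=> k /andP[_ kM]; rewrite leqNgt kM.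
    by rewrite big_nat [leRHS]big_nat; apply: ler_sum => k /andP[-> _].
  rewrite -{1}[M]add0n big_addn addKn -mulr_sumr.
  have -> : \sum_(0 <= k < B) rho ^+ (k + M) = rho ^+ M * \sum_(k < B) rho ^+ k.
    by rewrite big_mkord mulr_sumr; apply: eq_bigr => k _; rewrite -exprD addnC.
  have sg : \sum_(k < B) rho ^+ k <= (1 - rho)^-1.
    rewrite -[leRHS]mul1r ler_pdivlMr ?subr_gt0//.
    have := subrX1 rho B; have := exprn_ge0 B (ltW rho0); lra.
  rewrite mulrA /K [leRHS]mulrAC; apply: ler_wpM2l sg.
  by rewrite !mulr_ge0 ?expR_ge0 ?exprn_ge0// ltW.
apply/eqP; rewrite eq_le; apply/andP; split; last first.
  apply: (@le_trans _ _ (bowen_M Z s eps 0)); last by apply: ereal_sup_ubound; exists 0%N.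
  apply: le_ereal_inf_tmp => _ [cv _ <-]; apply: nneseries_ge0 => i _ _.
  by case: (cv i) => // -[_ n]; rewrite lee_fin expR_ge0.
apply: ge_ereal_sup => _ [N _ <-].
apply/lee_addgt0Pr => e e_gt0; rewrite add0e.
have : K * rho ^+ n @[n --> \oo] --> K * 0.
  apply: cvgMl_tmp; apply: cvg_expr; rewrite ger0_norm// ltW//.
rewrite mulr0 => /cvgrPdist_lt /(_ _ e_gt0) [n0 _ hn].
(* [M] is past [n0], so that the tail is small, and past [N + l], so that the orders [M - l] are
   admissible for [N]. *)
pose M := maxn n0 (N + l).
have lM : (N + l <= M)%N by rewrite leq_maxr.
have := hn M (leq_maxl _ _); rewrite sub0r normrN => hM.
apply: (@le_trans _ _ (bowen_M Z s eps (M - l))).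
  apply: ereal_inf_le_tmp => _ [cv [cv1 cv2] <-]; exists cv => //; split => //.
  by move=> i x n /cv1; apply: leq_trans; rewrite leq_subRL ?(leq_trans _ lM) ?leq_addl// addnC.
apply: (le_trans (cost M _)); first by rewrite (leq_trans _ lM)// leq_addl.
by rewrite lee_fin (le_trans (ler_norm _))// ltW.
Qed.

End UpperBound.

(** * Blocks with prescribed pair frequencies *)

Section Resolvent.
Variables (R : realType) (A : finType) (P : A -> A -> R).
Hypothesis P0 : forall i j, 0 <= P i j.
Hypothesis P1 : forall i, \sum_j P i j = 1.

(* [1 - kP] is invertible because [kP] contracts the sup norm. *)
Lemma resolvent (k : R) (h : A -> R) : 0 <= k < 1 ->
  exists g : A -> R, forall i, g i - k * \sum_j P i j * g j = h i.
Proof.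
move=> /andP[k0 k1].
(* The matrix is transposed, so that a row vector times [M] is $1-kP$ applied to a function. *)
pose M := \matrix_(j < #|A|, i < #|A|)
   ((i == j)%:R - k * P (enum_val i) (enum_val j)).
have actM (u : 'rV[R]_#|A|) i : (u *m M) ord0 (enum_rank i) =
    u ord0 (enum_rank i) - k * \sum_j P i j * u ord0 (enum_rank j).
  rewrite mxE (eq_bigr (fun j => (enum_rank i == j)%:R * u ord0 j -
     k * (P i (enum_val j) * u ord0 j))); last first.
    by move=> j _; rewrite mxE enum_rankK; ring.
  rewrite sumrB -mulr_sumr; congr (_ - k * _).
    rewrite (bigD1 (enum_rank i))//= eqxx mul1r big1 ?addr0// => j.
    by rewrite eq_sym => /negbTE ->; rewrite mul0r.
  rewrite (reindex (@enum_rank A))/=; last first.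
    by apply: onW_bij; exact: enum_rank_bij.
  by apply: eq_bigr => j _; rewrite enum_rankK.
have Mu : M \in unitmx.
  rewrite unitmxE unitfE; apply/det0P => -[v v0 vM].
  case/negP: v0; apply/eqP/rowP => i0; rewrite mxE.
  pose F (a : A) := `|v ord0 (enum_rank a)|.
  case: (@arg_maxP _ _ _ (enum_val i0) xpredT F isT) => a _ amax.
  have Fa : F a <= k * F a.
    have := actM v a; rewrite vM mxE => /eqP; rewrite eq_sym subr_eq0 => /eqP e.
    rewrite {1}/F e normrM ger0_norm// ler_wpM2l//.
    rewrite (le_trans (ler_norm_sum _ _ _))// -[leRHS]mul1r -(P1 a) mulr_suml.
    by apply: ler_sum => j _; rewrite normrM ger0_norm// ler_wpM2l//; exact: amax.
  have Fa0 : F a = 0.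
    have : 0 <= F a by exact: normr_ge0.
    by move=> ?; apply/eqP; rewrite eq_le; apply/andP; split => //; nra.
  have := amax (enum_val i0) isT; rewrite /= Fa0 /F enum_valK.
  by rewrite normr_le0 => /eqP.
exists (fun i => ((\row_j h (enum_val j)) *m invmx M) ord0 (enum_rank i)) => i.
by rewrite -actM mulmxKV// mxE enum_rankK.
Qed.

End Resolvent.

Section Blocks.
Variables (R : realType) (A : finType) (p : A -> R) (P : A -> A -> R).
Hypothesis p0 : forall i, 0 <= p i.
Hypothesis p1 : \sum_i p i = 1.
Hypothesis P0 : forall i j, 0 <= P i j.
Hypothesis P1 : forall i, \sum_j P i j = 1.
Hypothesis pP : forall j, \sum_i p i * P i j = p j.

Definition entropy (p : A -> R) (P : A -> A -> R) : R :=
  - \sum_i p i * \sum_j P i j * ln (P i j).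

(* Restarting from [p] with probability [e] keeps [p] stationary and makes the
   chain mix. *)
Definition restart (e : R) i j : R := (1 - e) * P i j + e * p j.

Lemma restart_ge0 e i j : 0 <= e <= 1 -> 0 <= restart e i j.
Proof. by move=> /andP[e0 e1]; rewrite addr_ge0// mulr_ge0// subr_ge0. Qed.

Lemma restart_sum e i : \sum_j restart e i j = 1.
Proof. by rewrite big_split /= -!mulr_sumr P1 p1; ring. Qed.

Lemma entropyE (Q : A -> A -> R) : entropy p Q = \sum_i p i * \sum_j eta (Q i j).
Proof.
by rewrite /entropy -sumrN; apply: eq_bigr => i _; rewrite /eta sumrN mulrN.
Qed.

Lemma p_le1 i : p i <= 1.
Proof. by rewrite -p1 (bigD1 i)//= lerDl sumr_ge0. Qed.

Lemma P_le1 i j : P i j <= 1.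
Proof. by rewrite -(P1 i) (bigD1 j)//= lerDl sumr_ge0. Qed.

(** Concavity of [eta], entry by entry; the term [e * eta (p j)] is dropped, being nonnegative
    because [p j <= 1]. *)
Lemma entropy_restart e : 0 <= e <= 1 ->
  (1 - e) * entropy p P <= entropy p (restart e).
Proof.
move=> he; rewrite !entropyE mulr_sumr; apply: ler_sum => i _.
rewrite mulrCA ler_wpM2l// mulr_sumr; apply: ler_sum => j _.
apply: le_trans (eta_concave he (P0 i j) (p0 j)); rewrite lerDl.
case/andP: he => e0 _; rewrite mulr_ge0// /eta oppr_ge0 mulr_ge0_le0//.
by rewrite ln_le0// p_le1.
Qed.

(** The Poisson equation of the restarted chain: up to the coboundary [g j - g i], the centred [f]
    becomes a martingale difference. [resolvent] solves it for $(1-e)P$, and the restart term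
    vanishes because [g] has [p]-mean 0. *)
Lemma poisson e (f : A -> A -> R) : 0 < e <= 1 ->
  exists g : A -> R, forall i, \sum_j restart e i j *
   (f i j - \sum_k p k * (\sum_l restart e k l * f k l) + (g j - g i)) = 0.
Proof.
move=> /andP[e0 e1].
set c := \sum_k _.
pose h i := \sum_j restart e i j * f i j - c.
have ke : 0 <= 1 - e < 1 by lra.
have [g gP] := resolvent P0 P1 h ke.
have ph : \sum_i p i * h i = 0.
  rewrite /h; under eq_bigr do rewrite mulrBr.
  by rewrite sumrB -mulr_suml p1 mul1r subrr.
(* Integrating the resolvent equation against the stationary [p] gives $p\cdot h=e\,(p\cdot g)$, and
   the left side is 0. *)
have pg : \sum_i p i * g i = 0.
  have : \sum_i p i * h i = e * \sum_i p i * g i.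
    transitivity (\sum_i p i * g i - (1 - e) * \sum_i p i * \sum_j P i j * g j).
      rewrite mulr_sumr -sumrB; apply: eq_bigr => i _; rewrite -gP; ring.
    have -> : \sum_i p i * \sum_j P i j * g j = \sum_j p j * g j.
      under eq_bigr do rewrite mulr_sumr.
      rewrite exchange_big /=; apply: eq_bigr => j _; rewrite -(pP j) mulr_suml.
      by apply: eq_bigr => i _; rewrite mulrA.
    ring.
  rewrite ph => /esym/eqP; rewrite mulf_eq0 => /orP[|/eqP//].
  by rewrite gt_eqF.
exists g => i.
rewrite (eq_bigr (fun j => restart e i j * f i j - restart e i j * (c + g i) +
   ((1 - e) * (P i j * g j) + e * (p j * g j)))); last first.
  by move=> j _; rewrite /restart; ring.
rewrite !big_split /= sumrN -mulr_suml restart_sum -!mulr_sumr pg.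
by have := gP i; rewrite /h; lra.
Qed.

(** Chebyshev's inequality and a union bound over the pairs, from each starting letter. A centred
    count differs from the martingale [psum (D kl)] by a boundary term of size at most [2 G], and
    the second moment of the martingale is at most [C * n]. *)
Lemma block_mean_dev (e tau : R) : 0 < e <= 1 -> 0 < tau ->
  exists n0 : nat, forall n, (n0 <= n)%N ->
  2^-1 <= \sum_a p a * \sum_(v <- words A n |
     [forall ij, `|(pcount ij a v)%:R - n%:R * (p ij.1 * restart e ij.1 ij.2)|
        <= tau * n%:R]) pprod (restart e) a v.
Proof.
move=> he tau0; have [e0 e1] := andP he.
have e01 : 0 <= e <= 1 by rewrite ltW.
have Q0 := fun i j => restart_ge0 i j e01.
pose f (kl : A * A) i j : R := ((i, j) == kl)%:R.
have fc kl : \sum_k p k * (\sum_l restart e k l * f kl k l) =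
    p kl.1 * restart e kl.1 kl.2.
  case: kl => k l /=; rewrite (bigD1 k)//= (bigD1 l)//= /f eqxx mulr1.
  rewrite big1 ?addr0 ?big1 ?addr0//.
    move=> i ik; rewrite big1 ?mulr0// => j _.
    by rewrite xpair_eqE (negbTE ik) mulr0.
  by move=> j jl; rewrite xpair_eqE (negbTE jl) andbF mulr0.
have /choice[g gP] := fun kl => poisson (f kl) he.
pose D kl i j := f kl i j - p kl.1 * restart e kl.1 kl.2 + (g kl j - g kl i).
have DQ kl i : \sum_j restart e i j * D kl i j = 0.
  by rewrite -[RHS](gP kl i) fc.
pose G := \sum_kl \sum_i `|g kl i|.
have gG kl i : `|g kl i| <= G.
  rewrite /G (bigD1 kl)//= (bigD1 i)//= -addrA lerDl addr_ge0// ?sumr_ge0//.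
  by move=> ? _; rewrite sumr_ge0.
pose C := \sum_kl \sum_i \sum_j D kl i j ^+ 2.
have DC kl i j : D kl i j ^+ 2 <= C.
  rewrite /C (bigD1 kl)//= (bigD1 i)//= (bigD1 j)//= -!addrA lerDl !addr_ge0//.
  - by rewrite sumr_ge0// => ? _; rewrite sqr_ge0.
  - by rewrite sumr_ge0// => ? _; rewrite sumr_ge0// => ? _; rewrite sqr_ge0.
  - rewrite sumr_ge0// => ? _; rewrite sumr_ge0// => ? _.
    by rewrite sumr_ge0// => ? _; rewrite sqr_ge0.
have C0 : 0 <= C.
  rewrite sumr_ge0// => ? _; rewrite sumr_ge0// => ? _.
  by rewrite sumr_ge0// => ? _; rewrite sqr_ge0.
have psumD kl a v : psum (D kl) a v = (pcount kl a v)%:R -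
    (size v)%:R * (p kl.1 * restart e kl.1 kl.2) + (g kl (last a v) - g kl a).
  elim: v a => [|b v IH] a /=; first by rewrite /=; ring.
  by rewrite IH /D /f natrD -natr1; ring.
pose N : R := #|{: A * A}|%:R.
(* The first term makes the boundary at most half of the deviation [tau * n]; the second makes the
   bad words weigh at most 1/2. *)
pose B := 4 * G / tau + 8 * N * C / tau ^+ 2.
exists (Num.bound B).+1 => n hn.
have G0 : 0 <= G by rewrite sumr_ge0// => ? _; rewrite sumr_ge0.
have h1 : 0 <= 4 * G / tau by rewrite divr_ge0 ?mulr_ge0// ltW.
have h2 : 0 <= 8 * N * C / tau ^+ 2 by rewrite divr_ge0 ?mulr_ge0 ?exprn_ge0// ltW.
have nB : B < n%:R.
  have := archi_boundP (addr_ge0 h1 h2); rewrite -/B => /lt_trans; apply.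
  by rewrite ltr_nat.
have n0 : 0 < n%:R :> R by apply: le_lt_trans nB; exact: addr_ge0.
have nG : 4 * G < tau * n%:R.
  by rewrite [ltRHS]mulrC -ltr_pdivrMr//; apply: le_lt_trans nB; rewrite lerDl.
have nC : 8 * N * C < tau ^+ 2 * n%:R.
  rewrite [ltRHS]mulrC -ltr_pdivrMr ?exprn_gt0//.
  by apply: le_lt_trans nB; rewrite lerDr.
pose good a v := [forall ij : A * A, `|(pcount ij a v)%:R -
  n%:R * (p ij.1 * restart e ij.1 ij.2)| <= tau * n%:R].
pose K := (tau * n%:R / 2) ^- 2.
have t0 : 0 < tau * n%:R / 2 by rewrite divr_gt0// mulr_gt0.
have K0 : 0 < K by rewrite invr_gt0 exprn_gt0.
have bad a v : v \in words A n -> ~~ good a v ->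
    1 <= \sum_kl K * psum (D kl) a v ^+ 2.
  rewrite mem_words => /eqP vn; rewrite negb_forall => /existsP[kl].
  rewrite -ltNge => hkl; rewrite (bigD1 kl)//= ler_wpDr//.
    by rewrite sumr_ge0// => i _; rewrite mulr_ge0 ?sqr_ge0// ltW.
  have hD : tau * n%:R / 2 <= `|psum (D kl) a v|.
    rewrite psumD vn; set x := _ - _ in hkl *.
    have := ler_normB (x + (g kl (last a v) - g kl a)) (g kl (last a v) - g kl a).
    have := ler_normB (g kl (last a v)) (g kl a).
    rewrite addrK; have := gG kl (last a v); have := gG kl a; lra.
  rewrite /K mulrC ler_pdivlMr ?exprn_gt0// mul1r -[leRHS]real_normK ?num_real//.
  by rewrite ler_pXn2r// nnegrE// ltW.
have row a : 2^-1 <= \sum_(v <- words A n | good a v) pprod (restart e) a v.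
  have := sum_pprod a n (restart_sum e); rewrite (bigID (good a)) /=.
  set S1 := \sum_(v <- _ | good a v) _; set S2 := \sum_(v <- _ | _) _.
  suff : S2 <= 2^-1 by lra.
  apply: (@le_trans _ _ (\sum_(v <- words A n) \sum_kl
      K * (pprod (restart e) a v * psum (D kl) a v ^+ 2))).
    rewrite /S2 big_mkcond /= !big_seq; apply: ler_sum => v vn.
    rewrite (eq_bigr (fun kl => pprod (restart e) a v * (K * psum (D kl) a v ^+ 2)));
      last by move=> kl _; ring.
    rewrite -mulr_sumr; case: ifPn => gv.
      by rewrite ler_peMr ?pprod_ge0//; exact: bad.
    rewrite mulr_ge0 ?pprod_ge0// sumr_ge0// => kl _.
    by rewrite mulr_ge0 ?sqr_ge0// ltW.
  rewrite exchange_big /=.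
  apply: (@le_trans _ _ (\sum_(kl : A * A) K * (C * n%:R))).
    apply: ler_sum => kl _; rewrite -mulr_sumr ler_wpM2l ?(ltW K0)//.
    exact: sum_pprod_psum_sqr (restart_sum e) (DQ kl) (DC kl).
  rewrite sumr_const -[leLHS]mulr_natl -/N /K mulrCA mulrC ler_pdivrMr ?exprn_gt0//.
  rewrite exprMn exprMn; have := ler_wpM2r (ltW n0) (ltW nC); lra.
have -> : 2^-1 = \sum_a p a * 2^-1 :> R by rewrite -mulr_suml p1 mul1r.
by apply: ler_sum => a _; rewrite ler_wpM2l//; exact: row.
Qed.

Definition word_pcount (ij : A * A) (w : seq A) : nat :=
  if w is a :: v then pcount ij a v else 0%N.

Lemma pcount_rcons ij a (v : seq A) b :
  pcount ij a (rcons v b) = (pcount ij a v + ((last a v, b) == ij))%N.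
Proof. by elim: v a => [|c v IH] a /=; rewrite ?addn0// IH addnA. Qed.

(* The letter [b] stands for the one following the block in a concatenation. *)
Lemma block_words (delta : R) : 0 < delta ->
  exists (l : nat) (W : seq (seq A)),
    [/\ (0 < l)%N, uniq W, (forall w, w \in W -> size w = l),
       expR (l%:R * (entropy p P - delta)) <= (size W)%:R
     & forall w b i j, w \in W ->
       `|(word_pcount (i, j) (rcons w b))%:R - l%:R * (p i * P i j)| <= delta * l%:R].
Proof.
move=> d0; set H := entropy p P.
pose d := Num.min delta 1.
have dd : d <= delta by rewrite ge_min lexx.
have d1 : d <= 1 by rewrite ge_min lexx orbT.
have d00 : 0 < d by rewrite lt_min d0 ltr01.
(* Error budget: [e] and [e * |H|] are at most [d / 4], and likewise [tau] and [tau * L] below. *)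
pose e := d / (4 * (`|H| + 1)).
have H1 : 0 < `|H| + 1 by rewrite ltr_wpDl.
have e0 : 0 < e by rewrite divr_gt0// mulr_gt0.
have eH : e * (4 * (`|H| + 1)) = d by rewrite divfK// mulf_neq0// gt_eqF.
have eN : 0 <= e * `|H| by rewrite mulr_ge0// ltW.
have e1 : e <= 1 by lra.
have he : 0 < e <= 1 by rewrite e0.
have e01 : 0 <= e <= 1 by rewrite ltW.
pose Q := restart e.
have Q0 i j : 0 <= Q i j by exact: restart_ge0.
pose L := \sum_(ij : A * A) `|ln (Q ij.1 ij.2)|.
have L0 : 0 <= L by rewrite sumr_ge0.
pose tau := d / (4 * (L + 1)).
have L1 : 0 < L + 1 by rewrite ltr_wpDl.
have tau0 : 0 < tau by rewrite divr_gt0// mulr_gt0.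
have tauL : tau * (4 * (L + 1)) = d by rewrite divfK// mulf_neq0// gt_eqF.
have tauL0 : 0 <= tau * L by rewrite mulr_ge0// ltW.
have [n0 hn0] := block_mean_dev he tau0.
(* Large [n] absorbs the bounded losses: the factor 1/2 in the mass, the [n + 1] letters against [n]
   transitions, and the pair ending in [b]. *)
pose B := 8 / d + 4 * (`|H| + 2) / d.
have h1 : 0 <= 8 / d by rewrite divr_ge0// ltW.
have h2 : 0 <= 4 * (`|H| + 2) / d by rewrite divr_ge0 ?mulr_ge0 ?addr_ge0// ltW.
pose n := maxn n0 (Num.bound B).
have nB : B < n%:R.
  by apply: lt_le_trans (archi_boundP (addr_ge0 h1 h2)) _; rewrite ler_nat leq_maxr.
have n1 : 8 < d * n%:R.
  by rewrite [ltRHS]mulrC -ltr_pdivrMr//; apply: le_lt_trans nB; rewrite lerDl.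
have n2 : 4 * (`|H| + 2) < d * n%:R.
  by rewrite [ltRHS]mulrC -ltr_pdivrMr//; apply: le_lt_trans nB; rewrite lerDr.
have := hn0 n (leq_maxl _ _); rewrite -/Q.
pose good a v := [forall ij : A * A, `|(pcount ij a v)%:R -
  n%:R * (p ij.1 * Q ij.1 ij.2)| <= tau * n%:R].
have goodP a v i j : good a v ->
    `|(pcount (i, j) a v)%:R - n%:R * (p i * Q i j)| <= tau * n%:R.
  by move/forallP/(_ (i, j)).
pose ok w := if w is a :: v then good a v && (0 < pprod Q a v) else false.
pose W := [seq w <- words A n.+1 | ok w].
have nn : 0 <= n%:R :> R by [].
have Hd : H - d / 4 <= entropy p Q.
  apply: le_trans (entropy_restart e01); rewrite -/H.
  have := ler_norm H; have := ler_norm (e * H); rewrite normrM gtr0_norm//; lra.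
(* The log-probability of a good word is $-n$ times the entropy of [Q], up to [tau * n * L]. Each
   good word thus has small mass, and total mass 1/2 forces many of them. *)
have mass a v : v \in words A n -> good a v -> 
    pprod Q a v <= (ok (a :: v))%:R * expR (- (n%:R * (H - d / 2))).
  rewrite mem_words => /eqP vn gv; rewrite /ok gv /=.
  have := pprod_ge0 a v Q0; rewrite le_eqVlt => /orP[/eqP <-|pv0].
    by rewrite mulr_ge0 ?expR_ge0.
  rewrite pv0 mul1r.
  have -> : pprod Q a v =
      expR (\sum_(ij : A * A) (pcount ij a v)%:R * ln (Q ij.1 ij.2)).
    move: pv0; rewrite pprodE expR_sum => /gt_eqF/negbT/prodf_neq0 pn0.
    apply: eq_bigr => ij _; have := pn0 ij isT.
    have [->|c0] := posnP (pcount ij a v); first by rewrite mul0r expR0.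
    rewrite expf_eq0 c0 /= => qn0.
    by rewrite expRM_natl lnK// posrE lt_neqAle eq_sym qn0 Q0.
  rewrite ler_expR.
  have -> : \sum_(ij : A * A) (pcount ij a v)%:R * ln (Q ij.1 ij.2) =
     - (n%:R * entropy p Q) + \sum_(ij : A * A) ((pcount ij a v)%:R -
        n%:R * (p ij.1 * Q ij.1 ij.2)) * ln (Q ij.1 ij.2).
    rewrite /entropy mulrN opprK mulr_sumr.
    under [X in _ = X + _]eq_bigr do rewrite mulrA mulr_sumr.
    rewrite pair_bigA -big_split /=.
    by apply: eq_bigr => ij _; ring.
  have : \sum_(ij : A * A) ((pcount ij a v)%:R -
        n%:R * (p ij.1 * Q ij.1 ij.2)) * ln (Q ij.1 ij.2) <= tau * n%:R * L.
    rewrite /L mulr_sumr; apply: ler_sum => -[i j] _ /=.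
    by rewrite (le_trans (ler_norm _))// normrM ler_wpM2r//; exact: goodP.
  have := ler_wpM2l nn Hd.
  have : tau * L * n%:R <= d / 4 * n%:R by rewrite ler_wpM2r//; lra.
  lra.
move=> hmass.
have cnt : 2^-1 <= expR (- (n%:R * (H - d / 2))) * (size W)%:R.
  apply: (le_trans hmass).
  have -> : (size W)%:R = \sum_a \sum_(v <- words A n) (ok (a :: v))%:R :> R.
    rewrite -(big_words (fun w => (ok w)%:R : R)) size_filter -sum1_count natr_sum.
    by rewrite big_mkcond /=; apply: eq_bigr => w _; case: (ok w).
  rewrite mulr_sumr; apply: ler_sum => a _.
  rewrite (@le_trans _ _ (\sum_(v <- words A n | good a v) pprod Q a v))//.
    by rewrite ler_piMl ?p_le1// sumr_ge0// => v _; exact: pprod_ge0.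
  rewrite mulr_sumr big_mkcond !big_seq; apply: ler_sum => v vn.
  rewrite mulrC; case: ifPn => gv; first exact: mass.
  by rewrite mulr_ge0 ?expR_ge0.
exists n.+1, W; split => //.
- by rewrite filter_uniq// uniq_words.
- by move=> w; rewrite mem_filter mem_words => /andP[_ /eqP].
- apply: (@le_trans _ _ (2^-1 * expR (n%:R * (H - d / 2)))); last first.
    rewrite -ler_pdivlMr ?expR_gt0// -expRN mulrC; exact: cnt.
  apply: (@le_trans _ _ (expR (-1) * expR (n%:R * (H - d / 2)))); last first.
    rewrite ler_wpM2r ?expR_ge0// expRN lef_pV2 ?posrE ?expR_gt0//.
    by have := expR_ge1Dx (1 : R); lra.
  rewrite -expRD ler_expR -natr1.
  have := ler_norm H; have := ler_wpM2r nn dd; lra.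
- move=> w b i j; rewrite mem_filter => /andP[]; case: w => // a v /andP[gv _].
  rewrite mem_words /= eqSS => /eqP vn.
  rewrite pcount_rcons natrD -natr1.
  have := goodP a v i j gv; set c := (pcount _ _ _)%:R; set b0 := (_ == _)%:R.
  have hb : 0 <= b0 <= 1 by rewrite /b0; case: eqP; rewrite ?lexx ?ler01.
  have hq : `|p i * Q i j - p i * P i j| <= e.
    rewrite (_ : _ - _ = (p i * (p j - P i j)) * e); last by rewrite /Q /restart; ring.
    rewrite normrM [X in _ * X]gtr0_norm// ler_piMl ?(ltW e0)//.
    rewrite normrM ger0_norm// mulr_ile1 ?normr_ge0 ?p_le1//.
    by rewrite ler_norml; have := p_le1 j; have := P_le1 i j; have := p0 j; have := P0 i j; lra.
  have hq' : 0 <= p i * P i j <= 1.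
    by rewrite mulr_ge0// mulr_ile1// ?p_le1 ?P_le1.
  have := ler_wpM2l nn hq; rewrite -[X in X * `|_|]ger0_norm// -normrM mulrBr.
  have te : tau * n%:R <= d / 4 * n%:R by rewrite ler_wpM2r//; lra.
  have ee : n%:R * e <= d / 4 * n%:R by rewrite mulrC ler_wpM2r//; lra.
  have ddn := ler_wpM2r nn dd.
  move: te ee ddn hq' hb n1; rewrite !ler_norml.
  set X := n%:R * (p i * Q i j); set Y := n%:R * (p i * P i j).
  rewrite (_ : (n%:R + 1) * (p i * P i j) = Y + p i * P i j); last by rewrite /Y; ring.
  move=> te ee ddn /andP[q1 q2] /andP[b1 b2] n1' /andP[h3 h4] /andP[h5 h6].
  by apply/andP; split; lra.
Qed.

End Blocks.

(** * Concatenations of blocks *)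

Section Moran.
Variables (R : realType) (m : nat) (len : nat -> nat) (W : nat -> seq (seq 'Z_m)).
Hypothesis len0 : forall k, (0 < len k)%N.
Hypothesis Wu : forall k, uniq (W k).
Hypothesis Wlen : forall k w, w \in W k -> size w = len k.
Hypothesis W0 : forall k, (0 < size (W k))%N.

Definition endpoint (k : nat) : nat := \sum_(j < k) len j.

Fixpoint level (k : nat) : seq (seq 'Z_m) :=
  if k is j.+1 then [seq v ++ w | v <- level j, w <- W j] else [:: [::]].

Lemma endpointS k : endpoint k.+1 = (endpoint k + len k)%N.
Proof. by rewrite /endpoint big_ord_recr. Qed.

Lemma leq_endpoint k : (k <= endpoint k)%N.
Proof. by elim: k => // k IH; rewrite endpointS; have := len0 k; lia. Qed.

Lemma endpoint_mono j k : (j <= k)%N -> (endpoint j <= endpoint k)%N.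
Proof.
by move/subnK <-; elim: (k - j)%N => // i IH; rewrite addSn endpointS (leq_trans IH)// leq_addr.
Qed.

Lemma endpoint_bracket n : exists k, (endpoint k <= n < endpoint k.+1)%N.
Proof.
have h : exists k, (n < endpoint k)%N by exists n.+1; exact: leq_endpoint.
case: (ex_minnP h) => -[|k] hk kmin; first by rewrite /endpoint big_ord0 in hk.
exists k; rewrite hk andbT leqNgt; apply/negP => /kmin; by rewrite ltnn.
Qed.

Lemma size_level k v : v \in level k -> size v = endpoint k.
Proof.
elim: k v => [|k IH] v /=; first by rewrite inE => /eqP ->; rewrite /endpoint big_ord0.
case/allpairsP => -[u w] [/= uk wk ->].
by rewrite size_cat endpointS (IH u)// (Wlen wk).
Qed.

Lemma take_level j k v : (j <= k)%N -> v \in level k -> take (endpoint j) v \in level j.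
Proof.
move/subnK <-; elim: (k - j)%N v => [|i IH] v; first by rewrite add0n => vj; rewrite take_oversize ?(size_level vj).
rewrite addSn => /allpairsP[[u w] [/= uk wk ->]].
rewrite takel_cat; first exact: IH.
by rewrite (size_level uk) endpoint_mono// leq_addl.
Qed.

Lemma uniq_level k : uniq (level k).
Proof.
elim: k => //= k IH; apply: allpairs_uniq => //.
move=> [u w] [u' w'] /allpairsP[[a b] [/= ak bk [-> ->]]].
case/allpairsP => [[a' b'] [/= ak' bk' [-> ->]]] /eqP.
by rewrite eqseq_cat ?(size_level ak) ?(size_level ak')// => /andP[/eqP -> /eqP ->].
Qed.

Lemma size_levelS k : size (level k.+1) = (size (level k) * size (W k))%N.
Proof. by rewrite /= size_allpairs. Qed.

Lemma level_gt0 k : (0 < size (level k))%N.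
Proof. by elim: k => // k IH; rewrite size_levelS muln_gt0 IH W0. Qed.

(** Each word of [level j] has the same number of extensions in [level k], so a prefix [u] carries
    at most the share [1 / size (level j)] of the uniform measure. *)
Lemma count_level j k u : (j <= k)%N ->
  (count (fun v => take (endpoint j) v == u) (level k) * size (level j)
    <= size (level k))%N.
Proof.
move/subnK <-; elim: (k - j)%N => [|i IH].
  rewrite add0n (@eq_in_count _ _ (pred1 u)); last first.
    by move=> v vj /=; rewrite take_oversize ?(size_level vj).
  by rewrite count_uniq_mem ?uniq_level//; case: (_ \in _); rewrite ?mul1n.
rewrite addSn size_levelS.
suff -> : count (fun v => take (endpoint j) v == u) (level (i + j).+1) =
    (count (fun v => take (endpoint j) v == u) (level (i + j)) * size (W (i + j)))%N.
  by rewrite mulnAC leq_mul2r IH orbT.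
rewrite /= -sumn_count -sumn_count.
have : forall s, {subset s <= level (i + j)} ->
  count (fun v => take (endpoint j) v == u) [seq v ++ w | v <- s, w <- W (i + j)] =
  (count (fun v => take (endpoint j) v == u) s * size (W (i + j)))%N.
  elim=> //= v s IHs sub; rewrite count_cat IHs; last first.
    by move=> z zs; apply: sub; rewrite inE zs orbT.
  rewrite mulnDl; congr addn; rewrite count_map.
  have vk : v \in level (i + j) by apply: sub; rewrite inE eqxx.
  rewrite (@eq_count _ _ (fun=> take (endpoint j) v == u)); last first.
    by move=> w /=; rewrite takel_cat// (size_level vk) endpoint_mono// leq_addl.
  by case: eqP => _; rewrite ?mul1n ?mul0n ?count_predT ?count_pred0.
by rewrite !sumn_count; exact.
Qed.

Variable c : nat -> option (Sigma m * nat).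

(** Being covered is read off the finite word [u]: the cylinder of [u] lies in the cylinder of one
    of the first [K] elements. *)
Definition covers (K : nat) (u : seq 'Z_m) : Prop :=
  exists i x n, [/\ (i < K)%N, c i = Some (x, n), (n <= size u)%N & take n u = mkseq x n].

(* Koenig's lemma: a word all of whose one-letter extensions are covered at
   finite depth is itself covered at finite depth. *)
Lemma finite_subcover :
  (forall x : Sigma m, (forall k, mkseq x (endpoint k) \in level k) ->
     exists i y n, c i = Some (y, n) /\ mkseq x n = mkseq y n) ->
  exists K, forall u, u \in level K -> covers K u.
Proof.
move=> cov; apply: contrapT => ncov.
(* [v] is bad when it has uncovered extensions at arbitrarily large depths. *)
pose bad v := forall K, exists k u, [/\ (K <= k)%N, u \in level k,
  take (size v) u = v & ~ covers K u].
have bad0 : bad [::].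
  move=> K; apply: contrapT => h; apply: ncov; exists K => u uK.
  by apply: contrapT => ncu; apply: h; exists K, u; split => //; rewrite take0.
(* The implication sits under the quantifier so that choice yields a letter after every word, and
   the limit point arises by plain iteration. *)
have step v : exists a, bad v -> bad (rcons v a).
  apply: contrapT => h.
  have /choice[f hf] : forall a, exists K, ~ exists k u, [/\ (K <= k)%N,
      u \in level k, take (size (rcons v a)) u = rcons v a & ~ covers K u].
    move=> a; apply: contrapT => h'; apply: h; exists a => _ K.
    by apply: contrapT => h''; apply: h'; exists K.
  have bv : bad v by apply: contrapT => nb; apply: h; exists 0.
  (* Beyond this depth no letter would extend [v] badly, by finiteness of the alphabet; yet the
     letter following [v] in an uncovered [u] does. *)
  pose K := maxn (size v).+1 (\max_a f a).
  have [k [u [Kk uk uv nc]]] := bv K.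
  have sv : (size v < size u)%N.
    by rewrite (size_level uk) (leq_trans _ (leq_endpoint k))// (leq_trans _ Kk)// leq_maxl.
  pose b : 'Z_m := nth 0 u (size v).
have fK : (f b <= K)%N.
    rewrite (leq_trans _ (leq_maxr _ _))//.
    exact: (@leq_bigmax _ f).
  apply: (hf b); exists k, u; split => //.
  - exact: leq_trans Kk.
  - by rewrite size_rcons (take_nth (0 : 'Z_m))// uv.
  - move=> [i [x [n [iK ci nu tn]]]]; apply: nc; exists i, x, n; split => //.
    exact: leq_trans fK.
have /choice[f hf] := step.
pose w n := iter n (fun v => rcons v (f v)) [::].
pose x : Sigma m := fun n => f (w n).
have xw n : mkseq x n = w n by elim: n => // n IH; rewrite mkseqS IH.
have badx n : bad (mkseq x n).
  by rewrite xw; elim: n => // n IH /=; exact: hf.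
have [k|i [y [n [ci xy]]]] := cov x.
  have [k' [u [kk' uk' <- _]]] := badx (endpoint k) k.
  by rewrite size_mkseq; exact: take_level uk'.
have [k [u [nk uk tu nc]]] := badx n (maxn i.+1 n).
apply: nc; exists i, y, n; rewrite leq_maxl; split => //.
  rewrite (size_level uk) (leq_trans _ (leq_endpoint k))// (leq_trans _ nk)// leq_maxr.
  done.
by rewrite -xy -[in LHS](size_mkseq x n) tu.
Qed.

(** Mass distribution principle for the uniform measure on [level K]: an element of order [n] in the
    [k]-th block catches a share of at most [1 / size (level k)], hence at most $C e^{-sn}$, and the
    shares add up to at least 1. *)
Lemma moran_cost (s C : R) : 
  (forall k n, (endpoint k <= n < endpoint k.+1)%N ->
     expR (s * n%:R) <= C * (size (level k))%:R) ->
  (exists K, forall u, u \in level K -> covers K u) ->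
  (1 <= C%:E * cover_cost s c)%E.
Proof.
move=> sC [K cK].
have C0 : 0 < C.
  have [k /sC] := endpoint_bracket 0; rewrite mulr0 expR0 => h.
  by have := level_gt0 k; rewrite -(ltr_nat R); nra.
pose t i : R := match c i with Some (_, n) => expR (- (s * n%:R)) | None => 0 end.
have t0 i : 0 <= t i by rewrite /t; case: (c i) => // -[? ?]; exact: expR_ge0.
suff h : 1 <= C * \sum_(i < K) t i.
  apply: (@le_trans _ _ (C%:E * (\sum_(i < K) t i)%:E)%E); first by rewrite -EFinM lee_fin.
  rewrite lee_wpmul2l ?lee_fin ?(ltW C0)//.
  rewrite (_ : cover_cost s c = (\sum_(0 <= i <oo) (t i)%:E)%E); last first.
    by apply: eq_eseriesr => i _; rewrite /t; case: (c i) => // -[].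
  rewrite -(big_mkord xpredT t) -sumEFin.
  by apply: nneseries_lim_ge => i _ _; rewrite lee_fin.
have LK : 0 < (size (level K))%:R :> R by rewrite ltr0n level_gt0.
rewrite -(ler_pM2r LK) mul1r -mulrA mulr_suml.
pose hit i u := if c i is Some (x, n) then (n <= size u)%N && (take n u == mkseq x n) else false.
apply: (@le_trans _ _ (\sum_(i < K) (count (hit i) (level K))%:R)).
  rewrite -natr_sum ler_nat -sum1_size.
  under [X in (_ <= X)%N]eq_bigr do rewrite -sum1_count big_mkcond.
  rewrite [X in (_ <= X)%N]exchange_big /= !big_seq; apply: leq_sum => u /cK[i [x [n [iK ci nu tu]]]].
  by rewrite (bigD1 (Ordinal iK))//= /hit ci nu tu eqxx.
rewrite mulr_sumr; apply: ler_sum => i _; rewrite /t /hit.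
case: (c i) => [[x n]|]; last by rewrite count_pred0 mul0r mulr0.
have [k /andP[kn nk]] := endpoint_bracket n.
(* An element longer than the words of [level K] catches none of them. *)
have [nK|Kn] := leqP n (endpoint K); last first.
  rewrite (@eq_in_count _ _ pred0) ?count_pred0; last first.
    by move=> u /size_level -> /=; rewrite leqNgt Kn.
  by rewrite mulr_ge0 ?(ltW C0)// mulr_ge0 ?expR_ge0.
have kK : (k <= K)%N.
  rewrite leqNgt; apply/negP => /endpoint_mono.
  have := @endpoint_mono K.+1 k; rewrite endpointS; have := len0 K; lia.
have h1 := count_level (mkseq x (endpoint k)) kK.
have h2 : (count (fun u => (n <= size u)%N && (take n u == mkseq x n)) (level K) <=
    count (fun v => take (endpoint k) v == mkseq x (endpoint k)) (level K))%N.
  apply: sub_count => u /= /andP[nu /eqP tu].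
  rewrite -(take_takel _ kn) tu; apply/eqP/(@eq_from_nth _ (0 : 'Z_m)).
    by rewrite size_takel size_mkseq.
  move=> l; rewrite size_takel ?size_mkseq// => lk.
  by rewrite nth_take// !nth_mkseq// (leq_trans lk).
have h3 := sC k n; rewrite kn nk in h3; have {}h3 := h3 isT.
have Lk : 0 < (size (level k))%:R :> R by rewrite ltr0n level_gt0.
rewrite -(ler_pM2r Lk).
apply: (@le_trans _ _ (size (level K))%:R).
  by rewrite -natrM ler_nat (leq_trans _ h1)// leq_mul2r h2 orbT.
rewrite expRN mulrA -[leLHS]mul1r mulrAC ler_wpM2r ?(ltW LK)//.
by rewrite mulrAC ler_pdivlMr ?expR_gt0// mul1r.
Qed.

End Moran.

(** At scale 1 a Bowen ball lies in a cylinder, so vanishing would give a cover by cylinders of cost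
    below [1 / C], against [moran_cost]. *)
Lemma moran_bowen_m_neq0 (R : realType) (m : nat) (len : nat -> nat)
    (W : nat -> seq (seq 'Z_m)) (Z : set (Sigma m)) (s C : R) :
  (forall k, (0 < len k)%N) -> (forall k, uniq (W k)) ->
  (forall k w, w \in W k -> size w = len k) -> (forall k, (0 < size (W k))%N) ->
  (forall x : Sigma m, (forall k, mkseq x (endpoint len k) \in level W k) -> Z x) ->
  (forall k n, (endpoint len k <= n < endpoint len k.+1)%N ->
     expR (s * n%:R) <= C * (size (level W k))%:R) ->
  bowen_m Z s 1 <> 0%E.
Proof.
move=> len0 Wu Wlen W0 ZW sC m0.
have C0 : 0 < C.
  have [k /sC] := endpoint_bracket len0 0; rewrite mulr0 expR0 => h.
  by have := level_gt0 W0 k; rewrite -(ltr_nat R); nra.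
have : (bowen_M Z s 1 0 < (C^-1)%:E)%E.
  apply: (@le_lt_trans _ _ 0%E); last by rewrite lte_fin invr_gt0.
  by rewrite -m0; apply: ereal_sup_ubound; exists 0%N.
move/ereal_inf_lt => [_ [c [_ Zc] <-]]; apply/negP; rewrite -leNgt.
have h : (1 <= C%:E * cover_cost s c)%E.
  apply: (@moran_cost _ _ len W) => //.
  apply: finite_subcover => // x /ZW/Zc[i _].
  case ci : (c i) => [[y n]|//] /bowen_ball1 xy; exists i, y, n; split => //.
  apply: (@eq_from_nth _ (0 : 'Z_m)); rewrite !size_mkseq// => k kn.
  by rewrite !nth_mkseq// xy.
by rewrite -[leLHS]mule1 lee_pdivrMl.
Qed.

(** * Lower bound *)

Section Visits.
Variables (R : realType) (A : eqType).

Definition visits (x : nat -> A) (ij : A * A) (n : nat) : R :=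
  \sum_(t < n) ((x t, x t.+1) == ij)%:R.

Lemma visits_add x ij n k : visits x ij (n + k) =
  visits x ij n + visits (fun t => x (n + t)%N) ij k.
Proof.
rewrite /visits big_split_ord /=; congr (_ + _).
by apply: eq_bigr => t _; rewrite addnS.
Qed.

Lemma visits_bound x ij n : 0 <= visits x ij n <= n%:R.
Proof.
rewrite sumr_ge0//= -[leRHS](_ : \sum_(t < n) 1 = _).
  by apply: ler_sum => t _; case: eqP => _; rewrite ?ler01.
by rewrite sumr_const card_ord.
Qed.

End Visits.

Lemma visits_pcount (R : realType) (A : finType) (x : nat -> A) ij n :
  visits R x ij n = (pcount ij (x 0%N) (mkseq (fun t => x t.+1) n))%:R.
Proof.
elim: n x => [|n IH] x; first by rewrite /visits big_ord0.
rewrite -add1n visits_add IH /= natrD.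
rewrite /visits big_ord1; congr (_ + (pcount _ _ _)%:R).
by rewrite add0n (iotaDl 1 0) -map_comp; apply: eq_map.
Qed.

(* Each stage is kept until the past is long compared with the next block. *)
Lemma slow_stage (l : nat -> nat) : exists st : nat -> nat,
  (forall k, st k * l (st k) <= k)%N /\
  (forall J, exists k0, forall k, (k0 <= k)%N -> (J <= st k)%N).
Proof.
pose P k (j : 'I_k.+1) := (j * l j <= k)%N.
have P0 k : P k ord0 by rewrite /P mul0n.
exists (fun k => nat_of_ord [arg max_(j > ord0 | P k j) (j : nat)]); split => [k|J].
  by case: arg_maxnP => // j.
exists (maxn J (J * l J)) => k; rewrite geq_max => /andP[Jk lJ].
case: arg_maxnP => // j _ jmax.
have Jk' : (J < k.+1)%N by [].
exact: (jmax (Ordinal Jk')).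
Qed.

Section LowerBound.
Variables (R : realType) (m : nat) (p : 'Z_m -> R) (P : 'Z_m -> 'Z_m -> R).
Hypothesis pP : couple p P.

(** Scale 1 suffices, the entropy being a supremum over scales. An exponent [s] below [H] is refuted
    by concatenating blocks of tolerance [d (st k)]; both the accumulated tolerance and the current
    block are negligible against the past length. *)
Theorem htop_ge (Z : set (Sigma m)) :
  (forall x : Sigma m, (forall i j (e : R), 0 < e -> exists n0 : nat, forall n,
     (n0 <= n)%N -> `|visits R x (i, j) n - n%:R * (p i * P i j)| <= e * n%:R) ->
     Z x) ->
  ((H2 p P)%:E <= htop R Z)%E.
Proof.
case: pP => p0 p1 P0 P1 pPp ZP; rewrite -[H2 p P]/(entropy p P); set H := entropy p P.
apply: (@le_trans _ _ (bowen_h_eps Z 1)); last first.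
  by apply: ereal_sup_ubound; exists 1 => //=.
apply: le_ereal_inf_tmp => _ [s /= ms <-]; rewrite lee_fin leNgt; apply/negP => sH.
move: ms; pose d (j : nat) : R := j.+1%:R^-1.
have d0 j : 0 < d j by rewrite invr_gt0 ltr0n.
have /choice[l /choice[B lB]] := fun j => block_words p0 p1 P0 P1 pPp (d0 j).
have [st [stk st_oo]] := slow_stage l.
pose len k := l (st k); pose W k := B (st k).
have len0 k : (0 < len k)%N by have [] := lB (st k).
have Wu k : uniq (W k) by have [] := lB (st k).
have Wlen k w : w \in W k -> size w = len k by have [_ _ h _ _] := lB (st k); exact: h.
have Wcard k : expR ((len k)%:R * (H - d (st k))) <= (size (W k))%:R.
  by have [] := lB (st k).
have Wcnt k w b i j : w \in W k -> `|(word_pcount (i, j) (rcons w b))%:R -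
    (len k)%:R * (p i * P i j)| <= d (st k) * (len k)%:R.
  by have [_ _ _ _ h] := lB (st k); exact: h.
have W0 k : (0 < size (W k))%N.
  by rewrite -(ltr_nat R); apply: lt_le_trans (Wcard k); rewrite expR_gt0.
have small (e : R) : 0 < e -> exists k0, forall k, (k0 <= k)%N ->
    d (st k) <= e /\ (len k)%:R <= e * (endpoint len k)%:R.
  move=> e0; have [k0 hk0] := st_oo (Num.bound e^-1).
  exists k0 => k /hk0 h.
  have he : e^-1 < (st k)%:R.
    by apply: (lt_le_trans (archi_boundP _)); rewrite ?ler_nat// invr_ge0 ltW.
  have st0 : 0 < (st k)%:R :> R by apply: lt_trans he; rewrite invr_gt0.
  split.
    rewrite /d -[leRHS]invrK lef_pV2 ?posrE ?invr_gt0// (le_trans (ltW he))//.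
    by rewrite ler_nat.
  rewrite -ler_pdivrMl// (le_trans (ler_wpM2r _ (ltW he)))//.
  by rewrite -natrM ler_nat (leq_trans (stk k))// leq_endpoint.
(* Before stage [k0] the tolerances are only bounded by 1, which costs the fixed term
   [endpoint len k0]. *)
have dsum (e : R) : 0 < e -> exists k0, (forall k, (k0 <= k)%N ->
      (len k)%:R <= e * (endpoint len k)%:R) /\
    (forall k, \sum_(j < k) d (st j) * (len j)%:R <=
      (endpoint len k0)%:R + e * (endpoint len k)%:R).
  move=> e0; have [k0 hk0] := small e e0.
  exists k0; split => [k /hk0[]//|].
  elim=> [|k IH]; first by rewrite big_ord0 addr_ge0// mulr_ge0// ltW.
  rewrite big_ord_recr /= [in leRHS]endpointS natrD.
  have [k0k|kk0] := leqP k0 k.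
    have [h _] := hk0 k k0k.
    have := ler_wpM2r (ler0n R (len k)) h; lra.
  have h : \sum_(j < k.+1) d (st j) * (len j)%:R <= (endpoint len k.+1)%:R.
    rewrite /endpoint natr_sum; apply: ler_sum => j _.
    by rewrite ler_piMl// invf_le1 ?ltr0n// ler1n.
  rewrite big_ord_recr /= in h.
  apply: (le_trans h); rewrite ler_wpDr//; first by rewrite mulr_ge0// ?ltW// addr_ge0.
  by rewrite ler_nat endpoint_mono.
have sizeL k : expR ((endpoint len k)%:R * H - \sum_(j < k) d (st j) * (len j)%:R) <=
    (size (level W k))%:R.
  elim: k => [|k IH]; first by rewrite /endpoint !big_ord0 mul0r subr0 expR0.
  rewrite size_levelS natrM (le_trans _ (ler_pM _ _ IH (Wcard k))) ?expR_ge0//.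
  by rewrite -expRD ler_expR big_ord_recr /= endpointS natrD; lra.
pose eta' := H - s; have eta0 : 0 < eta' by rewrite /eta'; lra.
(* The gap [H - s] pays for two losses: [e] in the number of words and [e * |s|] for the incomplete
   block. The initial stages are absorbed in [C]. *)
pose e := eta' / (`|s| + 1).
have s1 : 0 < `|s| + 1 by rewrite ltr_wpDl.
have e0 : 0 < e by rewrite divr_gt0.
have eE : e * (`|s| + 1) = eta' by rewrite divfK// gt_eqF.
have [k0 [k0len k0sum]] := dsum e e0.
pose C := expR ((endpoint len k0)%:R * (`|s| + 1)).
apply: (@moran_bowen_m_neq0 _ _ len W Z s C) => //; last first.
  move=> k n /andP[kn nk].
  have [k0k|kk0] := leqP k0 k; last first.
    apply: (@le_trans _ _ (C * 1)); last first.
      by rewrite ler_wpM2l ?expR_ge0// ler1n level_gt0.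
    rewrite mulr1 ler_expR.
    have h : n%:R <= (endpoint len k0)%:R :> R.
      by rewrite ler_nat (leq_trans (ltnW nk))// endpoint_mono.
    have := ler_wpM2r (ler0n R n) (ler_norm s); have := ler_wpM2l (normr_ge0 s) h.
    by have := ler0n R (endpoint len k0); lra.
  apply: le_trans (ler_wpM2l (expR_ge0 _) (sizeL k)).
  rewrite -expRD ler_expR.
  have h1 := k0len k k0k; have h2 := k0sum k.
  set T := (endpoint len k)%:R in h1 h2 *; set T0 := (endpoint len k0)%:R in h2 *.
  have Tn : 0 <= n%:R - T <= e * T.
    rewrite subr_ge0 ler_nat kn /=; apply: le_trans h1.
    by rewrite lerBlDl -natrD ler_nat -endpointS ltnW.
  have [Tn0 Tn1] := andP Tn.
  have := ler_wpM2r Tn0 (ler_norm s); have := ler_wpM2l (normr_ge0 s) Tn1.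
  have : e * (`|s| + 1) * T = (H - s) * T by rewrite eE.
  have : 0 <= T0 * `|s| by rewrite mulr_ge0.
  lra.
move=> x xL; apply: ZP => i j e' e'0.
have e'4 : 0 < e' / 4 by lra.
have [k1 [k1len k1sum]] := dsum (e' / 4) e'4.
set q := p i * P i j.
have q01 : 0 <= q <= 1.
  by rewrite mulr_ge0// mulr_ile1// ?(p_le1 p0 p1) ?(P_le1 P0 P1).
have block k : `|visits R (fun t => x (endpoint len k + t)%N) (i, j) (len k) -
    (len k)%:R * q| <= d (st k) * (len k)%:R.
  rewrite visits_pcount.
  pose w := mkseq (fun t => x (endpoint len k + t)%N) (len k).
  have wW : w \in W k.
    have /allpairsP[[u v] [/= uk vk e2]] := xL k.+1.
    suff -> : w = v by [].
    have := congr1 (drop (endpoint len k)) e2.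
    rewrite drop_size_cat ?(size_level Wlen uk)// => <-.
    rewrite /w /mkseq endpointS iotaD map_cat drop_size_cat ?size_map ?size_iota//.
    by rewrite add0n -[endpoint len k in RHS]addn0 iotaDl -map_comp.
  have := Wcnt k w (x (endpoint len k + len k)%N) i j wW.
  by rewrite -(mkseqS (fun t => x (endpoint len k + t)%N)) /= (iotaDl 1 0) -map_comp.
have ends k : `|visits R x (i, j) (endpoint len k) - (endpoint len k)%:R * q| <=
    \sum_(j < k) d (st j) * (len j)%:R.
  elim: k => [|k IH]; first by rewrite /visits /endpoint !big_ord0 mul0r subrr normr0.
  rewrite endpointS visits_add natrD mulrDl big_ord_recr /=.
  have := lerD IH (block k); apply: le_trans; apply: le_trans (ler_normD _ _).
  by rewrite le_eqVlt; apply/orP; left; apply/eqP; congr (`|_|); ring.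
pose T1 := endpoint len k1.
(* Three errors of at most a quarter of [e' * n] each: the initial stages, the tolerances of
   complete blocks, and the incomplete block. *)
pose n0 := maxn T1 (Num.bound (4 * T1%:R / e')).
exists n0 => n; rewrite geq_max => /andP[T1n hn].
have hn' : 4 * T1%:R <= e' * n%:R.
  rewrite [leRHS]mulrC -ler_pdivrMr// ltW//.
  apply: (lt_le_trans (archi_boundP _)); last by rewrite ler_nat.
  by rewrite divr_ge0 ?mulr_ge0// ltW.
have [k /andP[kn nk]] := endpoint_bracket len0 n.
have k1k : (k1 <= k)%N.
  rewrite leqNgt; apply/negP => /(endpoint_mono len) h.
  by have := leq_ltn_trans T1n nk; rewrite /T1 ltnNge h.
have := ends k; have := k1sum k; have := k1len k k1k; rewrite -/T1.
have nE : n = (endpoint len k + (n - endpoint len k))%N by rewrite subnKC.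
have := visits_bound R (fun t => x (endpoint len k + t)%N) (i, j) (n - endpoint len k).
have : (n - endpoint len k)%:R <= (len k)%:R :> R.
  by rewrite ler_nat leq_subLR -endpointS ltnW.
have : (endpoint len k)%:R <= n%:R :> R by rewrite ler_nat.
have -> : visits R x (i, j) n = visits R x (i, j) (endpoint len k) +
    visits R (fun t => x (endpoint len k + t)%N) (i, j) (n - endpoint len k).
  by rewrite {1}nE visits_add.
have nE' : n%:R = (endpoint len k)%:R + (n - endpoint len k)%:R :> R.
  by rewrite -natrD -nE.
set V := visits _ _ _ (endpoint _ _); set V' := visits _ _ _ _.
move: nE' hn'; set T := (endpoint _ _)%:R; set r := (n - _)%:R; set S := \sum_(_ < _) _.
move=> nE' hn' Tn rl /andP[V0 Vr] lT S1 VS.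
have r0 : 0 <= r by [].
have rq : 0 <= r * q <= r.
  by case/andP: q01 => q0 q1; rewrite mulr_ge0//= ler_piMr.
have e4T : e' / 4 * T <= e' / 4 * n%:R by rewrite ler_wpM2l// ltW.
rewrite (_ : _ - _ = (V - T * q) + (V' - r * q)); last by rewrite nE'; ring.
apply: (le_trans (ler_normD _ _)).
have : `|V' - r * q| <= r by rewrite ler_norml; lra.
lra.
Qed.

End LowerBound.

(** * Averages, integrals and the maximizer *)

Section Averages.
Variables (R : realType) (m r : nat) (phi : 'I_r -> 'Z_m -> 'Z_m -> R).

Definition Fmean (q : 'Z_m * 'Z_m -> R) : R :=
  \prod_(k < r) \sum_ij phi k ij.1 ij.2 * q ij.

Lemma Fmean_couple p P : Fmean (fun ij => p ij.1 * P ij.1 ij.2) =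
  \prod_(k < r) \sum_(i : 'Z_m) \sum_(j : 'Z_m) phi k i j * p i * P i j.
Proof.
apply: eq_bigr => k _; rewrite pair_bigA.
by apply: eq_bigr => ij _; rewrite mulrA.
Qed.

Lemma sum_psum (A : finType) (f : A -> A -> R) (y : nat -> A) n :
  \sum_(t < n) f (y t) (y t.+1) = psum f (y 0%N) (mkseq (fun t => y t.+1) n).
Proof.
elim: n y => [|n IH] y; first by rewrite big_ord0.
rewrite big_ord_recl /=; congr (_ + _).
rewrite (IH (fun t => y t.+1)) /mkseq (iotaDl 1 0) -map_comp.
by congr (psum _ _ _); apply: eq_map.
Qed.

(* The averages run over [sigma^i x] with [i >= 1], so [x 0] is never seen. *)
Definition orbit_freq (x : Sigma m) (n : nat) : 'Z_m * 'Z_m -> R :=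
  pair_freq R (x 1%N) (mkseq (fun t => x t.+2) n).

Lemma mult_avgE n x : mult_avg phi n x = Fmean (orbit_freq x n).
Proof.
rewrite /mult_avg /Phi.
under eq_bigr do under eq_bigr do rewrite !iter_shiftE add0n add1n.
rewrite -(bigA_distr_bigA (fun k (i : 'I_n) => phi k (x i.+1) (x i.+2))).
have -> : n%:R ^- r = \prod_(k < r) n%:R^-1 :> R.
  by rewrite prodr_const card_ord exprVn.
rewrite -big_split /=; apply: eq_bigr => k _.
rewrite (sum_psum (phi k) (fun t => x t.+1)) psumE mulr_sumr; apply: eq_bigr => ij _.
by rewrite mulrCA /orbit_freq /pair_freq size_mkseq [_^-1 * _]mulrC.
Qed.

(** [Phi] is a finite combination of indicators of rectangles fixing two letters in each factor;
    distributivity turns the resulting sum into the product. *)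
Lemma Aint_formula p P (nu : {measure set (SigmaR m r) -> \bar R}) :
  is_markov_prod p P nu ->
  Aint phi nu = (\prod_(k < r) \sum_(i : 'Z_m) \sum_(j : 'Z_m)
    phi k i j * p i * P i j)%:E.
Proof.
move=> hnu; rewrite -Fmean_couple /Fmean bigA_distr_bigA /=.
pose E (c : {ffun 'I_r -> 'Z_m * 'Z_m}) : set (SigmaR m r) :=
  rect (fun k => [:: (c k).1; (c k).2]).
pose a (c : {ffun 'I_r -> 'Z_m * 'Z_m}) : R := \prod_k phi k (c k).1 (c k).2.
have mE c : measurable (E c).
  by apply: sub_sigma_algebra; exists (fun k => [:: (c k).1; (c k).2]).
have nuE c : nu (E c) = (\prod_k (p (c k).1 * P (c k).1 (c k).2))%:E.
  by rewrite /E hnu; congr EFin; apply: eq_bigr => k _ /=; rewrite mulr1.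
have EX c (X : SigmaR m r) : \1_(E c) X = (c == [ffun k => (X k 0%N, X k 1%N)])%:R :> R.
  rewrite indicE; congr (_%:R); congr nat_of_bool; apply/idP/eqP => [/set_mem h| ->].
    apply/ffunP => k; rewrite ffunE (h k 0%N)// (h k 1%N)//.
    by case: (c k).
  by apply: mem_set => k; rewrite ffunE => -[|[|]].
have PhiE (X : SigmaR m r) : (Phi phi X)%:E = (\sum_c (a c)%:E * (\1_(E c) X)%:E)%E.
  rewrite (bigD1 [ffun k => (X k 0%N, X k 1%N)])//= EX eqxx mule1 big1 ?adde0.
    by congr EFin; apply: eq_bigr => k _; rewrite ffunE.
  by move=> c /negbTE hc; rewrite EX hc mule0.
have iE c : nu.-integrable setT (fun X => (\1_(E c) X)%:E : \bar R).
  apply/integrableP; split; first by apply/measurable_EFinP; exact: measurable_indic.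
  under eq_integral do rewrite gee0_abs ?lee_fin//.
  by rewrite integral_indic// setIT nuE ltry.
rewrite /Aint (eq_integral (fun X => (\sum_c (a c)%:E * (\1_(E c) X)%:E)%E))//.
rewrite integral_sum//; last by move=> c; apply: integrableZl.
rewrite -sumEFin; apply: eq_bigr => c _.
rewrite integralZl// integral_indic// setIT nuE -EFinM -big_split /=.
by [].
Qed.

Lemma orbit_freqE x ij n :
  orbit_freq x n ij = visits R (fun t => x t.+1) ij n / n%:R.
Proof. by rewrite /orbit_freq /pair_freq size_mkseq visits_pcount. Qed.

(** Starting at time 1 instead of 0 drops a single visit, which disappears on division by [n]. *)
Lemma orbit_freq_cvg x i j (q : R) :
  (forall e : R, 0 < e -> exists n0 : nat, forall n,
     (n0 <= n)%N -> `|visits R x (i, j) n - n%:R * q| <= e * n%:R) ->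
  orbit_freq x n (i, j) @[n --> \oo] --> q.
Proof.
move=> h; apply/cvgrPdist_le => e e0.
have e2 : 0 < e / 2 by lra.
have [n0 hn0] := h _ e2.
near=> n.
have nn0 : (n0 <= n.+1)%N by rewrite leqW//; near: n; exact: nbhs_infty_ge.
have n1 : (0 < n)%N by near: n; exact: nbhs_infty_gt.
have nB : (2 + `|q| + e) * 2 / e < n%:R.
  by near: n; exact: nbhs_infty_gtr.
move: nB; rewrite ltr_pdivrMr// => nB.
have nR : 0 < n%:R :> R by rewrite ltr0n.
have := hn0 _ nn0; rewrite orbit_freqE -[X in visits _ _ _ X]add1n visits_add.
have := visits_bound R x (i, j) 1.
set v1 := visits _ _ _ 1; set v := visits _ _ _ n => /andP[v10 v11] hv.
rewrite -(ler_pM2r nR) -[X in _ * X](gtr0_norm nR) -normrM mulrBl divfK ?gt_eqF//.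
rewrite distrC ?(gtr0_norm nR).
have -> : v - q * n%:R = (v1 + v - n.+1%:R * q) + (q - v1).
  by rewrite -natr1; ring.
apply: (le_trans (ler_normD _ _)); rewrite -natr1 in hv.
have := ler_normB q v1; rewrite (ger0_norm v10); rewrite -natr1; lra.
Unshelve. all: by end_near. Qed.

Lemma Fmean_cvg (u : nat -> 'Z_m * 'Z_m -> R) q :
  (forall ij, u n ij @[n --> \oo] --> q ij) ->
  Fmean (u n) @[n --> \oo] --> Fmean q.
Proof.
move=> h; apply: cvg_big; first exact: mul_continuous.
move=> k _; apply: cvg_big; first exact: add_continuous.
by move=> ij _; apply: cvgM; [exact: cvg_cst|exact: h].
Qed.

Lemma htop_ge_couple p P alpha : couple p P ->
  \prod_(k < r) (\sum_(i : 'Z_m) \sum_(j : 'Z_m) phi k i j * p i * P i j) = alpha ->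
  ((H2 p P)%:E <= htop R (level_set phi alpha))%E.
Proof.
move=> pP <-; apply: htop_ge => // x hx.
rewrite /level_set /= -Fmean_couple.
under eq_cvg do rewrite mult_avgE.
apply: Fmean_cvg => -[i j]; apply: orbit_freq_cvg; exact: hx.
Qed.

End Averages.

(** From $e^x\ge1+x$, $n+1\le(1+1/a)e^{na}$; raise to the power [M]. The choice
    [a = delta / (M + 1)] stays meaningful at [M = 0]. *)
Lemma natS_exp_bound (R : realType) (M : nat) (delta : R) : 0 < delta ->
  exists2 c : R, 0 <= c & forall n : nat, n.+1%:R ^+ M <= c * expR (n%:R * delta).
Proof.
move=> d0; pose a := delta / M.+1%:R.
have a0 : 0 < a by rewrite divr_gt0.
exists ((1 + a^-1) ^+ M); first by rewrite exprn_ge0// addr_ge0// invr_ge0 ltW.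
move=> n; have h : n.+1%:R <= (1 + a^-1) * expR (n%:R * a).
  have ha : 0 < 1 + a^-1 by rewrite addr_gt0// invr_gt0.
  apply: le_trans (ler_wpM2l (ltW ha) (expR_ge1Dx _)).
  have e : a^-1 * (n%:R * a) = n%:R by rewrite mulrCA mulVf ?gt_eqF// mulr1.
  rewrite mulrDl mul1r mulrDr mulr1 e -natr1.
  have : 0 <= n%:R * a by rewrite mulr_ge0// ltW.
  have : 0 < a^-1 by rewrite invr_gt0.
  lra.
apply: (le_trans (lerXn2r M _ _ h)); rewrite ?nnegrE// ?(le_trans _ h)//.
rewrite exprMn ler_wpM2l ?exprn_ge0 ?addr_ge0 ?invr_ge0 ?(ltW a0)//.
rewrite -expRM_natl ler_expR mulrCA ler_wpM2l//.
rewrite /a mulrCA ler_piMr ?(ltW d0)// ler_pdivrMr// mul1r.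
by rewrite ler_nat.
Qed.

Section RealContinuity.
Variables (R : realType) (T : topologicalType).
Implicit Types f g : T -> R.

Lemma fun_continuousD f g : continuous f -> continuous g ->
  continuous (fun x => f x + g x).
Proof. by move=> cf cg x; apply: cvgD; [exact: cf|exact: cg]. Qed.

Lemma fun_continuousB f g : continuous f -> continuous g ->
  continuous (fun x => f x - g x).
Proof. by move=> cf cg x; apply: cvgB; [exact: cf|exact: cg]. Qed.

Lemma fun_continuous_norm f : continuous f -> continuous (fun x => `|f x|).
Proof. by move=> cf x; apply: cvg_norm; exact: cf. Qed.

Lemma fun_continuousM (a : R) f : continuous f -> continuous (fun x => a * f x).
Proof. by move=> cf x; apply: cvgM; [exact: cvg_cst|exact: cf]. Qed.

Lemma fun_continuous_comp (h : R -> R) f : continuous h -> continuous f ->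
  continuous (fun x => h (f x)).
Proof. by move=> ch cf x; apply: continuous_comp; [exact: cf|exact: ch]. Qed.

Lemma fun_continuous_sum (I : Type) (s : seq I) (f : I -> T -> R) :
  (forall i, continuous (f i)) -> continuous (fun x => \sum_(i <- s) f i x).
Proof. by move=> h; apply: continuous_big => //; exact: add_continuous. Qed.

Lemma fun_continuous_prod (I : Type) (s : seq I) (f : I -> T -> R) :
  (forall i, continuous (f i)) -> continuous (fun x => \prod_(i <- s) f i x).
Proof. by move=> h; apply: continuous_big => //; exact: mul_continuous. Qed.

Lemma fun_continuous_cst (a : R) : continuous (fun _ : T => a).
Proof. by move=> x; exact: cvg_cst. Qed.

End RealContinuity.

(** * Compactness of pair distributions and the upper bound *)

Section Maximizer.
Import ArrowAsProduct.
Variables (R : realType) (m r : nat) (phi : 'I_r -> 'Z_m -> 'Z_m -> R) (alpha : R).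
Hypothesis hm : (1 < m)%N.

Let Q : topologicalType := ('Z_m * 'Z_m -> R).

(** One continuous penalty for three constraints: total mass 1, shift-invariance, and mean
    [alpha]. *)
Definition defect (q : 'Z_m * 'Z_m -> R) : R :=
  `|\sum_ij q ij - 1| + \sum_i `|\sum_j q (i, j) - \sum_j q (j, i)| +
  `|Fmean phi q - alpha|.

Lemma coord_continuous (ij : 'Z_m * 'Z_m) : continuous (fun q : Q => q ij).
Proof. exact: (@proj_continuous _ (fun _ => R : topologicalType) ij). Qed.

Lemma defect_continuous : continuous (defect : Q -> R).
Proof.
apply: (@fun_continuousD R Q).
  apply: (@fun_continuousD R Q).
    apply: (@fun_continuous_norm R Q).
    apply: (@fun_continuousB R Q); last exact: (@fun_continuous_cst R Q).
    apply: (@fun_continuous_sum R Q); exact: coord_continuous.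
  apply: (@fun_continuous_sum R Q) => i; apply: (@fun_continuous_norm R Q).
  by apply: (@fun_continuousB R Q); apply: (@fun_continuous_sum R Q) => j;
    exact: coord_continuous.
apply: (@fun_continuous_norm R Q).
apply: (@fun_continuousB R Q); last exact: (@fun_continuous_cst R Q).
apply: (@fun_continuous_prod R Q) => k; apply: (@fun_continuous_sum R Q) => ij.
by apply: (@fun_continuousM R Q); exact: coord_continuous.
Qed.

Lemma pair_entropy_continuous : continuous (@pair_entropy R 'Z_m : Q -> R).
Proof.
apply: (@fun_continuousB R Q).
  apply: (@fun_continuous_sum R Q) => ij.
  apply: (@fun_continuous_comp R Q); first exact: eta_continuous.
  exact: coord_continuous.
apply: (@fun_continuous_sum R Q) => i.
apply: (@fun_continuous_comp R Q); first exact: eta_continuous.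
by apply: (@fun_continuous_sum R Q) => j; exact: coord_continuous.
Qed.

Definition cube : set Q := [set q | forall ij, `[0, 1]%classic (q ij)].

Lemma cube_compact : compact cube.
Proof.
apply: (@tychonoff _ (fun _ => R : topologicalType) (fun _ => `[0, 1]%classic)).
by move=> _; exact: segment_compact.
Qed.

Lemma orbit_freq_cube x n : cube (orbit_freq R x n).
Proof.
move=> ij /=; rewrite in_itv /= orbit_freqE.
have /andP[v0 vn] := visits_bound R (fun t => x t.+1) ij n.
rewrite divr_ge0//=; case: n v0 vn => [|n] v0 vn; first by rewrite invr0 mulr0.
by rewrite ler_pdivrMr// mul1r.
Qed.

(** The mass is exactly 1, and by [pcount_balance] each letter is out of balance by at most one
    visit. *)
Lemma defect_orbit_freq x n : (0 < n)%N ->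
  defect (orbit_freq R x n) <= #|'Z_m|%:R / n%:R + `|mult_avg phi n x - alpha|.
Proof.
move=> n0; have nR : 0 < n%:R :> R by rewrite ltr0n.
rewrite mult_avgE /defect lerD2r.
have -> : \sum_ij orbit_freq R x n ij = 1.
  rewrite /orbit_freq /pair_freq -mulr_suml -natr_sum sum_pcount size_mkseq mulfV//.
  by rewrite gt_eqF.
rewrite subrr normr0 add0r.
rewrite -mulr_natl mulr1 mulr_natl -sumr_const.
apply: ler_sum => i _; rewrite /orbit_freq /pair_freq -!mulr_suml -mulrBl.
rewrite pcount_balance normrM size_mkseq [X in _ * X]gtr0_norm ?invr_gt0//.
rewrite ler_piMl ?invr_ge0//.
by do 2!case: eqP => _; rewrite ?subrr ?normr0 ?subr0 ?sub0r ?normrN ?normr1.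
Qed.

Theorem htop_le_max : level_set phi alpha !=set0 ->
  exists q, [/\ forall ij, 0 <= q ij, defect q = 0 &
    (htop R (level_set phi alpha) <= (pair_entropy q)%:E)%E].
Proof.
have dsmall x : level_set phi alpha x -> forall e : R, 0 < e ->
    \forall n \near \oo, defect (orbit_freq R x n) <= e.
  move=> hx e e0.
  have e2 : 0 < e / 2 by lra.
  move/cvgrPdist_le : hx => /(_ _ e2) hx.
  near=> n.
  have n1 : (0 < n)%N by near: n; exact: nbhs_infty_gt.
  apply: (le_trans (defect_orbit_freq x n1)).
  have : `|alpha - mult_avg phi n x| <= e / 2 by near: n.
  have : #|'Z_m|%:R * 2 / e < n%:R by near: n; exact: nbhs_infty_gtr.
  rewrite ltr_pdivrMr// distrC => h1 h2.
  have : #|'Z_m|%:R / n%:R <= e / 2 by rewrite ler_pdivrMr ?ltr0n//; lra.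
  lra.
move=> [x0 hx0].
have [q [qC dq qmax]] := approx_level_max cube_compact defect_continuous pair_entropy_continuous
  (fun q _ => addr_ge0 (addr_ge0 (normr_ge0 _) (sumr_ge0 _ (fun _ _ => normr_ge0 _))) (normr_ge0 _))
  (fun e e0 => let: ex_intro n hn := filter_ex (dsmall x0 hx0 e e0) in
     ex_intro2 _ _ _ (orbit_freq_cube x0 n) hn).
exists q; split => // [ij|].
  by have := qC ij; rewrite /= in_itv /= => /andP[].
apply: htop_le_words => // delta d0.
have d2 : 0 < delta / 2 by lra.
have [e e0 he] := qmax _ d2.
have [c1 c10 hc1] := natS_exp_bound #|{: 'Z_m * 'Z_m}| d2.
pose G0 (a : 'Z_m) v := (v != [::]) && (defect (pair_freq R a v) <= e).
(* The first letter is ignored, as in [orbit_freq]; a prefix of length [n] then has [n - 2]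
   pairs. *)
pose G (w : seq 'Z_m) := if w is _ :: a :: v then G0 a v else false.
(* The two letters preceding [v] are free, which gives the square of the alphabet size; the negative
   exponential corrects the length from [n] to [n + 2]. *)
pose D : R := #|'Z_m|%:R ^+ 2 * c1 * expR (- (2 * (pair_entropy q + delta))).
have D0 : 0 <= D by rewrite !mulr_ge0 ?expR_ge0.
exists G, D; split.
  case=> [|[|n]].
  - by rewrite /= big_cons big_nil /= mulr_ge0 ?expR_ge0.
  - rewrite big_mkcond big_words big1 ?mulr_ge0 ?expR_ge0// => a _.
    by rewrite big_seq1.
  rewrite big_mkcond big_words.
  have bd (a : 'Z_m) : \sum_(v <- words 'Z_m n | G0 a v) 1 <=
      c1 * expR (n%:R * (pair_entropy q + delta)).
    have [->|n0] := posnP n.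
      by rewrite big_cons big_nil /= mulr_ge0 ?expR_ge0.
    apply: (le_trans (count_words_le (a := a) (h := pair_entropy q + delta / 2) n0 _)).
      move=> v vn /andP[_ dv]; apply: he => //.
      move=> ij /=; rewrite in_itv /= pair_freq_ge0 /= /pair_freq ler_pdivrMr ?vn ?ltr0n//.
      by rewrite mul1r ler_nat -vn pcount_le.
        apply: (le_trans (ler_wpM2r (expR_ge0 _) (hc1 n))).
    rewrite -mulrA -expRD ler_wpM2l// ler_expR; lra.
  apply: (@le_trans _ _ (\sum_(b : 'Z_m) \sum_(a : 'Z_m) c1 * expR (n%:R * (pair_entropy q + delta)))).
    apply: ler_sum => b _; rewrite big_words; apply: ler_sum => a _.
    by rewrite -big_mkcond; exact: bd.
  rewrite !sumr_const -!mulrnA -[leLHS]mulr_natl natrM /D expr2.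
  rewrite -!mulrA !ler_wpM2l// -expRD ler_expR -!natr1; lra.
move=> x hx; have [N _ hN] := dsmall x hx e e0.
exists (N + 3)%N => // n /= nN.
have -> : n = (n - 3).+3 by lia.
have := hN (n - 3).+1; rewrite /= => hd.
rewrite /mkseq /= (iotaDl 3 0) -map_comp; rewrite /G0 /=.
move: hd; rewrite /orbit_freq /mkseq /= (iotaDl 1 0) -map_comp; apply; lia.
Unshelve. all: by end_near. Qed.

End Maximizer.

(** * From pair distributions to couples, and the conclusion *)

Lemma couple_of_defect0 (R : realType) (m r : nat) (phi : 'I_r -> 'Z_m -> 'Z_m -> R)
    (alpha : R) (q : 'Z_m * 'Z_m -> R) :
  (forall ij, 0 <= q ij) -> defect phi alpha q = 0 ->
  exists p P, [/\ couple p P, H2 p P = pair_entropy q & Fmean phi (fun ij => p ij.1 * P ij.1 ij.2) = alpha].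
Proof.
move=> q0 /eqP.
have s0 : 0 <= \sum_i `|\sum_j q (i, j) - \sum_j q (j, i)| by rewrite sumr_ge0.
rewrite /defect paddr_eq0 ?addr_ge0// paddr_eq0// !normr_eq0 !subr_eq0.
move=> /andP[/andP[/eqP q1 hb] /eqP qa].
have bal i : \sum_j q (j, i) = \sum_j q (i, j).
  move: hb; rewrite psumr_eq0// => /allP/(_ i (mem_index_enum _)) /=.
  by rewrite normr_eq0 subr_eq0 => /eqP.
pose p i := \sum_j q (i, j).
(* A letter of mass 0 still needs a stochastic row; the point mass at 0 serves, and its weight in
   [H2] is zero. *)
pose P i j := if p i == 0 then (j == 0)%:R else q (i, j) / p i.
have p0 i : 0 <= p i by rewrite sumr_ge0.
have qp i j : p i = 0 -> q (i, j) = 0.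
  move=> /eqP; rewrite psumr_eq0// => /allP/(_ j (mem_index_enum _)) /=.
  by move/eqP.
have pPq i j : p i * P i j = q (i, j).
  rewrite /P; case: eqVneq => [pi0|pi0]; first by rewrite pi0 mul0r qp.
  by rewrite mulrC divfK.
exists p, P; split.
- split => //.
  + by rewrite -q1 (eq_bigr (fun ij => q (ij.1, ij.2))) ?pair_bigA// => -[].
  + by move=> i j; rewrite /P; case: ifP => // _; rewrite divr_ge0.
  + move=> i; rewrite /P; case: eqVneq => [_|pi0].
      by rewrite (bigD1 0)//= ?eqxx big1 ?addr0// => j /negbTE ->.
    by rewrite -mulr_suml mulfV.
  + by move=> j; rewrite (eq_bigr (fun i => q (i, j))) ?bal.
- rewrite pair_entropyE// /H2; congr (- _).
  under eq_bigr do rewrite mulr_sumr.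
  rewrite pair_bigA; apply: eq_bigr => -[i j] _ /=.
  rewrite mulrA pPq -/(p i) /P; case: eqVneq => [pi0|//].
  by rewrite qp// !mul0r.
- by rewrite -qa; apply: eq_bigr => k _; apply: eq_bigr => -[i j] _ /=; rewrite pPq.
Qed.

Theorem theorem5p4 (R : realType) (m r : nat) (hm : (2 <= m)%N) (hr : (1 <= r)%N)
  (phi : 'I_r -> 'Z_m -> 'Z_m -> R)
  (nu : ('Z_m -> R) -> ('Z_m -> 'Z_m -> R) -> {measure set (SigmaR m r) -> \bar R})
  (hnu : forall p P, couple p P -> is_markov_prod p P (nu p P)) :
  (forall p P, couple p P ->
     Aint phi (nu p P) = (\prod_(k < r) \sum_(i : 'Z_m) \sum_(j : 'Z_m)
                             phi k i j * p i * P i j)%:E)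
  /\
  (forall alpha : R, level_set phi alpha !=set0 ->
     (exists p P, [/\ couple p P, Aint phi (nu p P) = alpha%:E
                    & htop R (level_set phi alpha) = (H2 p P)%:E])
     /\
     (forall p P, couple p P -> Aint phi (nu p P) = alpha%:E ->
        ((H2 p P)%:E <= htop R (level_set phi alpha))%E)).
Proof.
have hA p P : couple p P -> Aint phi (nu p P) =
    (\prod_(k < r) \sum_(i : 'Z_m) \sum_(j : 'Z_m) phi k i j * p i * P i j)%:E.
  by move=> /hnu; exact: Aint_formula.
have lower alpha p P : couple p P -> Aint phi (nu p P) = alpha%:E ->
    ((H2 p P)%:E <= htop R (level_set phi alpha))%E.
  by move=> pP; rewrite hA// => -[]; exact: htop_ge_couple.
split=> [//|alpha E0]; split; last exact: lower.
(* The maximizer bounds the entropy from above, and its couple satisfies the constraint, so [lower]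
   turns the bound into an equality. *)
have [q [q0 dq hq]] := htop_le_max hm E0.
have [p [P [pP Hpq Fa]]] := couple_of_defect0 q0 dq.
have AE : Aint phi (nu p P) = alpha%:E by rewrite hA// -Fmean_couple Fa.
exists p, P; split => //; apply/eqP; rewrite eq_le lower// andbT.
by rewrite Hpq.
Qed.
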